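(* Let $\varphi\in\mathrm{Aut}(\mathbb{D})$, let $\alpha>0$, and let $\psi(z)=\exp\left(\alpha\frac{z+1}{z-1}\right)$ for $z\in\mathbb{D}$. Then $C_\varphi$ is an automorphism of $\psi H^\infty$ if and only if $\varphi(1)=1$ and $\varphi'(1)=1$.
   Context: $\mathbb{D}$ is the open unit disc in $\mathbb{C}$; $\mathrm{Aut}(\mathbb{D})$ is the set of bijective analytic self-maps of $\mathbb{D}$; each such $\varphi$ extends analytically to a neighbourhood of $\overline{\mathbb{D}}$, and $\varphi(1)$, $\varphi'(1)$ refer to this extension. $H^\infty$ is the algebra of bounded analytic functions on $\mathbb{D}$; $\psi H^\infty=\{\psi f: f\in H^\infty\}$; $C_\varphi f=f\circ\varphi$. An automorphism of a (not necessarily unital) algebra is a bijective, linear, multiplicative self-map of it; that $C_\varphi$ is an automorphism of $\psi H^\infty$ includes that it maps $\psi H^\infty$ into itself. *)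

(* Defs.v *)
From Stdlib Require Import Reals.
From Coquelicot Require Import Coquelicot.

Open Scope R_scope.

(** A function on the open unit disc is represented by a total function
    [C -> C] whose values outside the disc are irrelevant: two functions are
    the same element of a function algebra when they satisfy [eq_on_disc]. *)

Definition unit_disc (z : C) : Prop := Cmod z < 1.

Definition closed_unit_disc (z : C) : Prop := Cmod z <= 1.

Definition eq_on_disc (f g : C -> C) : Prop :=
  forall z : C, unit_disc z -> f z = g z.

(** Complex differentiability at every point of [U]; only used for open [U]. *)
Definition analytic_on (U : C -> Prop) (f : C -> C) : Prop :=
  forall z : C, U z -> @ex_derive C_AbsRing C_NormedModule f z.

Definition Aut_disc (phi : C -> C) : Prop :=
  analytic_on unit_disc phi /\
  (forall z : C, unit_disc z -> unit_disc (phi z)) /\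
  (forall z w : C, unit_disc z -> unit_disc w -> phi z = phi w -> z = w) /\
  (forall w : C, unit_disc w -> exists z : C, unit_disc z /\ phi z = w).

(** [Phi] extends [phi] analytically to a neighbourhood of the closed disc.
    By density of the disc in its closure, the value and the derivative of
    [Phi] at a point of the unit circle do not depend on the extension. *)
Definition analytic_extension (phi Phi : C -> C) : Prop :=
  eq_on_disc Phi phi /\
  exists U : C -> Prop,
    @open C_UniformSpace U /\
    (forall z : C, closed_unit_disc z -> U z) /\
    analytic_on U Phi.

Definition H_infty (f : C -> C) : Prop :=
  analytic_on unit_disc f /\
  exists M : R, forall z : C, unit_disc z -> Cmod (f z) <= M.

Definition mult_H_infty (psi : C -> C) (h : C -> C) : Prop :=
  exists f : C -> C, H_infty f /\ eq_on_disc h (fun z => (psi z * f z)%C).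

Definition composition_operator (phi : C -> C) (f : C -> C) : C -> C :=
  fun z => f (phi z).

(** [A] is a possibly non-unital algebra of functions on the disc under the
    pointwise operations, and [T] is an operator on functions. *)
Definition algebra_automorphism
    (A : (C -> C) -> Prop) (T : (C -> C) -> (C -> C)) : Prop :=
  (forall f g, A f -> A g -> eq_on_disc f g -> eq_on_disc (T f) (T g)) /\
  (forall f, A f -> A (T f)) /\
  (forall f g, A f -> A g ->
     eq_on_disc (T (fun z => (f z + g z)%C)) (fun z => (T f z + T g z)%C)) /\
  (forall (c : C) f, A f ->
     eq_on_disc (T (fun z => (c * f z)%C)) (fun z => (c * T f z)%C)) /\
  (forall f g, A f -> A g ->
     eq_on_disc (T (fun z => (f z * g z)%C)) (fun z => (T f z * T g z)%C)) /\
  (forall f g, A f -> A g -> eq_on_disc (T f) (T g) -> eq_on_disc f g) /\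
  (forall g, A g -> exists f, A f /\ eq_on_disc (T f) g).

Definition Cexp (z : C) : C :=
  (exp (Re z) * cos (Im z), exp (Re z) * sin (Im z)).

Definition atomic_inner (alpha : R) (z : C) : C :=
  Cexp (RtoC alpha * ((z + 1) / (z - 1)))%C.

(* Main.v *)
Require Import Defs.
From Stdlib Require Import Reals Lra ClassicalEpsilon.
From Coquelicot Require Import Coquelicot.

(** Every disc automorphism is a rotated Moebius map
    [phi z = lam (z + b) / (1 + conj b z)]. Since [|psi| = exp (- alpha P)] for the
    Poisson kernel [P z = (1 - |z|^2) / |1 - z|^2], the operator [C_phi] is an
    automorphism of [psi H^infty] only if [P o phi - P] is bounded. Along the radius
    to [1] this first forces [phi 1 = 1]; then [P o phi - P / phi' 1] is constant,
    which forces [phi' 1 = 1]. Conversely, if [phi 1 = phi' 1 = 1], then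
    [(phi + 1) / (phi - 1) - (z + 1) / (z - 1)] is constant, so [psi o phi] is a
    constant multiple of [psi].

    The classification rests on Goursat's lemma, applied to [f (c + e^w)] on
    rectangles of height [2 PI]. This gives the maximum principle for functions that
    are merely complex differentiable, hence Schwarz's lemma and the openness and
    local invertibility of injective analytic maps. *)

(** * Complex differentiability *)

(** The coordinate w = (1 + z) / (1 - z) explains both conditions. It carries the disc to the right
    half-plane and 1 to infinity, [poisson] is its real part, and psi becomes e^(- alpha w). An
    automorphism of the disc that fixes 1 acts as w -> w / phi'(1) + i t with t real, so boundedness
    of [poisson (phi z) - poisson z] leaves only translations, and these multiply psi by a constant.
    The boundedness holds because psi itself lies in psi H^infty: psi o phi is psi times a bounded
    function, and surjectivity bounds the inverse ratio.

    The obstacle is that analytic means only differentiable at each point. No continuity of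
    derivatives is assumed, and singularities are not removed: a quotient (f z - f p) / (z - p) is
    handled as a function continuous at p and differentiable elsewhere. The inverse of an
    automorphism has to be proved differentiable, since Schwarz's lemma is applied to it and since
    preimages under C_phi are formed with it. *)

(** [Ccont] and [has_Cderiv] use the modulus, which avoids moving between the product
    uniform structure of [C_NormedModule] and the one of [C_AbsRing]. *)
Definition Ccont (f : C -> C) (z : C) : Prop :=
  forall eps : R, 0 < eps -> exists delta : R, 0 < delta /\
    forall w : C, Cmod (w - z) < delta -> Cmod (f w - f z) < eps.

Definition has_Cderiv (f : C -> C) (z l : C) : Prop :=
  forall eps : R, 0 < eps -> exists delta : R, 0 < delta /\
    forall w : C, Cmod (w - z) < delta ->
      Cmod (f w - f z - l * (w - z)) <= eps * Cmod (w - z).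

Lemma has_Cderiv_is_derive (f : C -> C) (z l : C) :
  has_Cderiv f z l <-> @is_derive C_AbsRing C_NormedModule f z l.
Proof.
  split.
  - intros H; split.
    + exact (is_linear_scal_l (K := C_AbsRing) (V := C_NormedModule) l).
    + intros x Hx.
      apply (is_filter_lim_locally_unique (K := C_AbsRing)
               (V := AbsRing_NormedModule C_AbsRing)) in Hx.
      subst x. intros eps.
      destruct (H eps (cond_pos eps)) as [d [Hd HH]].
      exists (mkposreal d Hd). intros w Hw.
      specialize (HH w Hw).
      change (Cmod (f w - f z - (w - z) * l) <= eps * Cmod (w - z)).
      now rewrite (Cmult_comm (w - z) l).
  - intros [_ H] eps Heps.
    specialize (H z (fun P HP => HP) (mkposreal eps Heps)).
    destruct H as [d Hd].
    exists d; split; [apply cond_pos|].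
    intros w Hw. specialize (Hd w Hw).
    change (Cmod (f w - f z - (w - z) * l) <= eps * Cmod (w - z)) in Hd.
    now rewrite (Cmult_comm l (w - z)).
Qed.

Lemma Cmod_minus_sym (z w : C) : Cmod (z - w) = Cmod (w - z).
Proof. rewrite <- Cmod_opp. f_equal. ring. Qed.

Lemma Cmod_plus_ge (z w : C) : Cmod z - Cmod w <= Cmod (z + w).
Proof.
  pose proof (Cmod_triangle (z + w) (- w)) as H.
  rewrite Cmod_opp in H. replace (z + w + - w)%C with z in H by ring. lra.
Qed.

Lemma Cmod_minus_diag (z : C) : Cmod (z - z) = 0.
Proof. replace (z - z)%C with (RtoC 0) by ring. apply Cmod_0. Qed.

Lemma Ccont_const (c z : C) : Ccont (fun _ => c) z.
Proof.
  intros e He; exists 1; split; [lra|]. intros w _. now rewrite Cmod_minus_diag.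
Qed.

Lemma Ccont_id (z : C) : Ccont (fun w => w) z.
Proof. intros e He; exists e; auto. Qed.

Lemma Ccont_plus (f g : C -> C) (z : C) :
  Ccont f z -> Ccont g z -> Ccont (fun w => f w + g w)%C z.
Proof.
  intros Hf Hg e He.
  destruct (Hf (e / 2)) as [d1 [Hd1 H1]]; [lra|].
  destruct (Hg (e / 2)) as [d2 [Hd2 H2]]; [lra|].
  exists (Rmin d1 d2); split; [now apply Rmin_pos|].
  intros w Hw. apply Rmin_Rgt in Hw as [Hw1 Hw2].
  specialize (H1 w Hw1). specialize (H2 w Hw2).
  replace (f w + g w - (f z + g z))%C with ((f w - f z) + (g w - g z))%C by ring.
  eapply Rle_lt_trans; [apply Cmod_triangle|lra].
Qed.

Lemma Ccont_mult (f g : C -> C) (z : C) :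
  Ccont f z -> Ccont g z -> Ccont (fun w => f w * g w)%C z.
Proof.
  intros Hf Hg e He.
  set (B := 1 + Cmod (f z) + Cmod (g z)).
  pose proof (Cmod_ge_0 (f z)). pose proof (Cmod_ge_0 (g z)).
  assert (HB : 1 <= B) by (unfold B; lra).
  (* Since [e' <= 1], the three terms of the expansion below add up to less than [e' * B]. *)
  set (e' := Rmin 1 (e / B)).
  assert (He' : 0 < e') by (apply Rmin_pos; [lra|apply Rdiv_lt_0_compat; lra]).
  assert (He1 : e' <= 1) by apply Rmin_l.
  assert (HeB : e' * B <= e).
  { apply Rle_trans with (e / B * B).
    - apply Rmult_le_compat_r; [lra|apply Rmin_r].
    - apply Req_le; field; lra. }
  destruct (Hf e' He') as [d1 [Hd1 H1]].
  destruct (Hg e' He') as [d2 [Hd2 H2]].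
  exists (Rmin d1 d2); split; [now apply Rmin_pos|].
  intros w Hw. apply Rmin_Rgt in Hw as [Hw1 Hw2].
  specialize (H1 w Hw1). specialize (H2 w Hw2).
  replace (f w * g w - f z * g z)%C
    with ((f w - f z) * (g w - g z) + f z * (g w - g z) + (f w - f z) * g z)%C by ring.
  eapply Rle_lt_trans; [apply Cmod_triangle|].
  eapply Rle_lt_trans; [apply Rplus_le_compat_r, Cmod_triangle|].
  rewrite !Cmod_mult.
  pose proof (Cmod_ge_0 (f w - f z)). pose proof (Cmod_ge_0 (g w - g z)).
  assert (Cmod (f w - f z) * Cmod (g w - g z) < e' * 1) by
    (apply Rmult_le_0_lt_compat; lra).
  assert (Cmod (f z) * Cmod (g w - g z) <= Cmod (f z) * e') by
    (apply Rmult_le_compat_l; lra).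
  assert (Cmod (f w - f z) * Cmod (g z) <= e' * Cmod (g z)) by
    (apply Rmult_le_compat_r; lra).
  unfold B in HeB. lra.
Qed.

Lemma Ccont_comp (f g : C -> C) (z : C) :
  Ccont g z -> Ccont f (g z) -> Ccont (fun w => f (g w)) z.
Proof.
  intros Hg Hf e He.
  destruct (Hf e He) as [d1 [Hd1 H1]].
  destruct (Hg d1 Hd1) as [d2 [Hd2 H2]].
  exists d2; split; auto.
Qed.

Lemma Ccont_nonzero (f : C -> C) (z : C) :
  Ccont f z -> f z <> 0 ->
  exists delta, 0 < delta /\
    forall w, Cmod (w - z) < delta -> Cmod (f z) / 2 < Cmod (f w) /\ f w <> 0.
Proof.
  intros Hf Hz. apply Cmod_gt_0 in Hz.
  destruct (Hf (Cmod (f z) / 2)) as [d [Hd H]]; [lra|].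
  exists d; split; [easy|]. intros w Hw. specialize (H w Hw).
  rewrite Cmod_minus_sym in H.
  assert (Cmod (f z) / 2 < Cmod (f w)).
  { pose proof (Cmod_plus_ge (f z) (f w - f z)) as H1.
    rewrite (Cmod_minus_sym (f w)) in H1.
    replace (f z + (f w - f z))%C with (f w) in H1 by ring. lra. }
  split; [easy|]. apply Cmod_gt_0. lra.
Qed.

Lemma Ccont_inv (f : C -> C) (z : C) :
  Ccont f z -> f z <> 0 -> Ccont (fun w => / f w)%C z.
Proof.
  intros Hf Hz e He.
  destruct (Ccont_nonzero f z Hf Hz) as [d1 [Hd1 H1]].
  pose proof Hz as Hz'. apply Cmod_gt_0 in Hz'.
  set (m := Cmod (f z)) in *.
  (* The difference of the inverses has denominator [f w * f z], of modulus more than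
     [m / 2 * m]. *)
  destruct (Hf (e * (m * (m / 2)))) as [d2 [Hd2 H2]].
  { apply Rmult_lt_0_compat; [lra|]. apply Rmult_lt_0_compat; lra. }
  exists (Rmin d1 d2); split; [now apply Rmin_pos|].
  intros w Hw. apply Rmin_Rgt in Hw as [Hw1 Hw2].
  destruct (H1 w Hw1) as [H3 H4]. specialize (H2 w Hw2).
  replace (/ f w - / f z)%C with (- (f w - f z) / (f w * f z))%C by (field; auto).
  rewrite Cmod_div, Cmod_opp, Cmod_mult by (apply Cmult_neq_0; auto).
  fold m. apply (Rmult_lt_reg_r (Cmod (f w) * m)); [apply Rmult_lt_0_compat; lra|].
  unfold Rdiv at 1. rewrite Rmult_assoc, Rinv_l, Rmult_1_r by
    (apply Rgt_not_eq, Rmult_lt_0_compat; lra).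
  eapply Rlt_le_trans; [exact H2|].
  apply Rmult_le_compat_l; [lra|]. rewrite Rmult_comm. apply Rmult_le_compat_r; lra.
Qed.

Lemma Ccont_pow (f : C -> C) (n : nat) (z : C) :
  Ccont f z -> Ccont (fun w => f w ^ n)%C z.
Proof.
  intros Hf; induction n as [|n IH]; simpl.
  - apply Ccont_const.
  - now apply Ccont_mult.
Qed.

(** Carathéodory's form of the derivative: an increment that factors through a slope continuous at
    [z]. It turns the rules of differentiation into algebraic identities between slopes. *)
Lemma has_Cderiv_slope (f q : C -> C) (z : C) (r : R) :
  0 < r -> Ccont q z ->
  (forall w, Cmod (w - z) < r -> (f w - f z = q w * (w - z))%C) ->
  has_Cderiv f z (q z).
Proof.
  intros Hr Hq Heq e He.
  destruct (Hq e He) as [d [Hd H]].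
  exists (Rmin r d); split; [now apply Rmin_pos|].
  intros w Hw. apply Rmin_Rgt in Hw as [Hw1 Hw2].
  rewrite Heq by easy.
  replace (q w * (w - z) - q z * (w - z))%C with ((q w - q z) * (w - z))%C by ring.
  rewrite Cmod_mult. apply Rmult_le_compat_r; [apply Cmod_ge_0|].
  apply Rlt_le, H, Hw2.
Qed.

(** Setting the quotient to [l] at [z] makes the factorization hold at every [w], not only near [z].
    The same slope therefore serves globally, as f(z) / z in Schwarz's lemma and in the bounds for
    injective maps. *)
Lemma slope_of_has_Cderiv (f : C -> C) (z l : C) :
  has_Cderiv f z l ->
  exists q : C -> C, q z = l /\ Ccont q z /\
    forall w, (f w - f z = q w * (w - z))%C.
Proof.
  intros H.
  set (q := fun w => if Ceq_dec w z then l else ((f w - f z) / (w - z))%C).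
  assert (Hz : q z = l) by (unfold q; destruct (Ceq_dec z z); tauto).
  assert (Hn : forall w, w <> z -> (w - z <> 0)%C).
  { intros w Hw E. apply Hw. replace w with (w - z + z)%C by ring. rewrite E. ring. }
  exists q; split; [easy|]; split.
  - intros e He.
    destruct (H (e / 2)) as [d [Hd HH]]; [lra|].
    exists d; split; [easy|]. intros w Hw. rewrite Hz.
    unfold q; destruct (Ceq_dec w z) as [->|Hne].
    + now rewrite Cmod_minus_diag.
    + specialize (HH w Hw). pose proof (Hn w Hne) as Hw0.
      replace ((f w - f z) / (w - z) - l)%C
        with ((f w - f z - l * (w - z)) / (w - z))%C by (field; auto).
      rewrite Cmod_div by auto. apply Cmod_gt_0 in Hw0.
      apply Rle_lt_trans with (e / 2); [|lra].
      apply (Rmult_le_reg_r (Cmod (w - z))); [easy|].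
      unfold Rdiv at 1. rewrite Rmult_assoc, Rinv_l by lra. lra.
  - intros w. unfold q; destruct (Ceq_dec w z) as [->|Hne].
    + ring.
    + field; auto.
Qed.

Lemma has_Cderiv_cont (f : C -> C) (z l : C) : has_Cderiv f z l -> Ccont f z.
Proof.
  intros H. apply slope_of_has_Cderiv in H as [q [_ [Hq Heq]]].
  assert (H : Ccont (fun w => f z + q w * (w - z))%C z).
  { apply Ccont_plus; [apply Ccont_const|].
    apply Ccont_mult; [easy|].
    apply Ccont_plus; [apply Ccont_id|apply Ccont_const]. }
  intros e He. destruct (H e He) as [d [Hd H']].
  exists d; split; [easy|]. intros w Hw. specialize (H' w Hw).
  replace (f w) with (f z + (f w - f z))%C by ring. rewrite Heq.
  replace (f z) with (f z + q z * (z - z))%C at 2 by ring. exact H'.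
Qed.

Lemma has_Cderiv_eq (f : C -> C) (z l l' : C) :
  has_Cderiv f z l -> l = l' -> has_Cderiv f z l'.
Proof. now intros H <-. Qed.

Lemma has_Cderiv_ext_loc (f g : C -> C) (z l : C) (r : R) :
  0 < r -> (forall w, Cmod (w - z) < r -> f w = g w) ->
  has_Cderiv f z l -> has_Cderiv g z l.
Proof.
  intros Hr Heq H e He. destruct (H e He) as [d [Hd HH]].
  exists (Rmin r d); split; [now apply Rmin_pos|].
  intros w Hw. apply Rmin_Rgt in Hw as [Hw1 Hw2].
  rewrite <- (Heq w Hw1), <- (Heq z); [auto|].
  now rewrite Cmod_minus_diag.
Qed.

Lemma has_Cderiv_const (c z : C) : has_Cderiv (fun _ => c) z 0.
Proof.
  apply (has_Cderiv_slope (fun _ => c) (fun _ => RtoC 0) z 1); [lra|apply Ccont_const|].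
  intros w _. ring.
Qed.

Lemma has_Cderiv_id (z : C) : has_Cderiv (fun w => w) z 1.
Proof.
  apply (has_Cderiv_slope (fun w => w) (fun _ => RtoC 1) z 1); [lra|apply Ccont_const|].
  intros w _. ring.
Qed.

Lemma has_Cderiv_plus (f g : C -> C) (z l m : C) :
  has_Cderiv f z l -> has_Cderiv g z m -> has_Cderiv (fun w => f w + g w)%C z (l + m).
Proof.
  intros Hf Hg.
  apply slope_of_has_Cderiv in Hf as [q [<- [Hq Hfq]]].
  apply slope_of_has_Cderiv in Hg as [p [<- [Hp Hgp]]].
  apply (has_Cderiv_slope _ (fun w => q w + p w)%C z 1); [lra|now apply Ccont_plus|].
  intros w _.
  replace (f w + g w - (f z + g z))%C with ((f w - f z) + (g w - g z))%C by ring.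
  rewrite Hfq, Hgp. ring.
Qed.

Lemma has_Cderiv_mult (f g : C -> C) (z l m : C) :
  has_Cderiv f z l -> has_Cderiv g z m ->
  has_Cderiv (fun w => f w * g w)%C z (l * g z + f z * m).
Proof.
  intros Hf Hg. pose proof (has_Cderiv_cont g z m Hg) as Hgc.
  apply slope_of_has_Cderiv in Hf as [q [<- [Hq Hfq]]].
  apply slope_of_has_Cderiv in Hg as [p [<- [Hp Hgp]]].
  apply (has_Cderiv_slope _ (fun w => q w * g w + f z * p w)%C z 1); [lra| |].
  - apply Ccont_plus; apply Ccont_mult; auto using Ccont_const.
  - intros w _.
    replace (f w * g w - f z * g z)%C
      with ((f w - f z) * g w + f z * (g w - g z))%C by ring.
    rewrite Hfq, Hgp. ring.
Qed.

Lemma has_Cderiv_inv (f : C -> C) (z l : C) :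
  has_Cderiv f z l -> f z <> 0 ->
  has_Cderiv (fun w => / f w)%C z (- l / (f z * f z)).
Proof.
  intros Hf Hz. pose proof (has_Cderiv_cont f z l Hf) as Hfc.
  destruct (Ccont_nonzero f z Hfc Hz) as [d [Hd H]].
  apply slope_of_has_Cderiv in Hf as [q [<- [Hq Hfq]]].
  apply (has_Cderiv_slope _ (fun w => (- q w) * / (f w * f z))%C z d); [easy| |].
  - apply Ccont_mult.
    + apply (Ccont_comp Copp q); [easy|].
      intros e He; exists e; split; [easy|]; intros w Hw.
      replace (- w - - q z)%C with (- (w - q z))%C by ring. now rewrite Cmod_opp.
    + apply (Ccont_inv (fun w => f w * f z)%C).
      * apply Ccont_mult; auto using Ccont_const.
      * now apply Cmult_neq_0.
  - intros w Hw. destruct (H w Hw) as [_ Hw0].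
    replace (/ f w - / f z)%C with (- (f w - f z) / (f w * f z))%C by (field; auto).
    rewrite Hfq. field; auto.
Qed.

Lemma has_Cderiv_comp (f g : C -> C) (z l m : C) :
  has_Cderiv f (g z) l -> has_Cderiv g z m ->
  has_Cderiv (fun w => f (g w)) z (l * m).
Proof.
  intros Hf Hg. pose proof (has_Cderiv_cont g z m Hg) as Hgc.
  apply slope_of_has_Cderiv in Hf as [q [<- [Hq Hfq]]].
  apply slope_of_has_Cderiv in Hg as [p [<- [Hp Hgp]]].
  apply (has_Cderiv_slope _ (fun w => q (g w) * p w)%C z 1); [lra| |].
  - apply Ccont_mult; [|easy]. now apply Ccont_comp.
  - intros w _. rewrite Hfq, Hgp. ring.
Qed.

Lemma has_Cderiv_unique (f : C -> C) (z l m : C) :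
  has_Cderiv f z l -> has_Cderiv f z m -> l = m.
Proof.
  intros Hl Hm.
  apply has_Cderiv_is_derive, is_C_derive_unique in Hl.
  apply has_Cderiv_is_derive, is_C_derive_unique in Hm. congruence.
Qed.

(** * Goursat's lemma for rectangles *)

Lemma nested_intervals (a b : nat -> R) :
  (forall n, a n <= a (S n)) -> (forall n, b (S n) <= b n) ->
  (forall n, a n <= b n) ->
  exists x, forall n, a n <= x <= b n.
Proof.
  intros Ha Hb Hab.
  assert (Ha' : forall n k, a n <= a (n + k)%nat).
  { intros n k; induction k as [|k IH].
    - rewrite Nat.add_0_r; lra.
    - rewrite Nat.add_succ_r. eapply Rle_trans; [exact IH|apply Ha]. }
  assert (Hb' : forall n k, b (n + k)%nat <= b n).
  { intros n k; induction k as [|k IH].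
    - rewrite Nat.add_0_r; lra.
    - rewrite Nat.add_succ_r. eapply Rle_trans; [apply Hb|exact IH]. }
  assert (H : forall n m, a n <= b m).
  { intros n m. apply Rle_trans with (a (n + m)%nat); [apply Ha'|].
    apply Rle_trans with (b (n + m)%nat); [apply Hab|].
    rewrite Nat.add_comm. apply Hb'. }
  destruct (completeness (fun y => exists n, y = a n)) as [x [Hx1 Hx2]].
  - exists (b O). intros y [n ->]. apply H.
  - exists (a O). now exists O.
  - exists x. intros n; split.
    + apply Hx1. now exists n.
    + apply Hx2. intros y [m ->]. apply H.
Qed.

(** Cousin's lemma for rectangles. If [P] fails, it fails on some quarter, then on a quarter of that
    one, and so on; these rectangles shrink to a point, where the local hypothesis applies. *)
Lemma rectangle_bisection (P : R -> R -> R -> R -> Prop) (a b c d : R) :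
  a <= b -> c <= d ->
  (forall a b c d, a <= b -> c <= d ->
     P a ((a + b) / 2) c ((c + d) / 2) -> P ((a + b) / 2) b c ((c + d) / 2) ->
     P a ((a + b) / 2) ((c + d) / 2) d -> P ((a + b) / 2) b ((c + d) / 2) d ->
     P a b c d) ->
  (forall x y, a <= x <= b -> c <= y <= d ->
     exists delta, 0 < delta /\
       forall a' b' c' d', a' <= x <= b' -> c' <= y <= d' ->
         b' - a' < delta -> d' - c' < delta -> P a' b' c' d') ->
  P a b c d.
Proof.
  intros Hab Hcd Hsplit Hloc. apply NNPP; intros Hn.
  set (Bad := fun q : (R * R) * (R * R) =>
    fst (fst q) <= snd (fst q) /\ fst (snd q) <= snd (snd q) /\
    ~ P (fst (fst q)) (snd (fst q)) (fst (snd q)) (snd (snd q))).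
  set (Sub := fun q q' : (R * R) * (R * R) =>
    Bad q' /\
    fst (fst q) <= fst (fst q') /\ snd (fst q') <= snd (fst q) /\
    fst (snd q) <= fst (snd q') /\ snd (snd q') <= snd (snd q) /\
    snd (fst q') - fst (fst q') = (snd (fst q) - fst (fst q)) / 2 /\
    snd (snd q') - fst (snd q') = (snd (snd q) - fst (snd q)) / 2).
  assert (Hstep : forall q, Bad q -> exists q', Sub q q').
  { intros [[a1 b1] [c1 d1]] [H1 [H2 H3]]; simpl in *.
    apply NNPP; intros Hno. apply H3, Hsplit; try easy;
      apply NNPP; intros Hq; apply Hno; unfold Sub, Bad; simpl.
    - exists ((a1, (a1 + b1) / 2), (c1, (c1 + d1) / 2)); simpl.
      repeat split; try lra; easy.
    - exists (((a1 + b1) / 2, b1), (c1, (c1 + d1) / 2)); simpl.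
      repeat split; try lra; easy.
    - exists ((a1, (a1 + b1) / 2), ((c1 + d1) / 2, d1)); simpl.
      repeat split; try lra; easy.
    - exists (((a1 + b1) / 2, b1), ((c1 + d1) / 2, d1)); simpl.
      repeat split; try lra; easy. }
  (* The default value [q] is immaterial: along the sequence every rectangle is bad, so a bad
     quarter exists. *)
  set (next := fun q => epsilon (inhabits q) (fun q' => Sub q q')).
  set (Q := fix Q n := match n with O => ((a, b), (c, d)) | S n => next (Q n) end).
  assert (HQ : forall n, Bad (Q n) /\ Sub (Q n) (Q (S n))).
  { assert (HS : forall q, Bad q -> Sub q (next q)).
    { intros q Hq. apply (epsilon_spec (inhabits q) (fun q' => Sub q q')). auto. }
    intros n; induction n as [|n [_ IH]].
    - assert (Bad (Q O)) by (unfold Bad; simpl; auto). auto.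
    - assert (Bad (Q (S n))) by apply IH. split; [easy|]. now apply HS. }
  destruct (nested_intervals (fun n => fst (fst (Q n))) (fun n => snd (fst (Q n))))
    as [x Hx]; try (intros n; destruct (HQ n) as [[? [? ?]] [? [? [? [? [? ?]]]]]]; easy).
  destruct (nested_intervals (fun n => fst (snd (Q n))) (fun n => snd (snd (Q n))))
    as [y Hy]; try (intros n; destruct (HQ n) as [[? [? ?]] [? [? [? [? [? ?]]]]]]; easy).
  assert (Hw : forall n, snd (fst (Q n)) - fst (fst (Q n)) = (b - a) * (/ 2) ^ n /\
                         snd (snd (Q n)) - fst (snd (Q n)) = (d - c) * (/ 2) ^ n).
  { intros n; induction n as [|n [IH1 IH2]].
    - simpl; lra.
    - destruct (HQ n) as [_ [_ [_ [_ [_ [_ [H1 H2]]]]]]].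
      rewrite H1, H2, IH1, IH2. simpl; lra. }
  destruct (Hloc x y (Hx O) (Hy O)) as [e [He H]].
  (* The summand 1 keeps the denominator positive for a rectangle degenerate to a point. *)
  destruct (pow_lt_1_zero (/ 2)) with (y := e / (1 + (b - a) + (d - c))) as [N HN].
  { rewrite Rabs_right; lra. }
  { apply Rdiv_lt_0_compat; lra. }
  specialize (HN N (Nat.le_refl N)).
  assert (Hp : 0 < (/ 2) ^ N) by (apply pow_lt; lra).
  rewrite Rabs_right in HN by lra.
  apply (Rmult_lt_compat_l (1 + (b - a) + (d - c))) in HN; [|lra].
  replace ((1 + (b - a) + (d - c)) * (e / (1 + (b - a) + (d - c)))) with e in HN
    by (field; lra).
  assert (0 <= (b - a) * (/ 2) ^ N) by (apply Rmult_le_pos; lra).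
  assert (0 <= (d - c) * (/ 2) ^ N) by (apply Rmult_le_pos; lra).
  destruct (Hw N) as [Hw1 Hw2].
  destruct (HQ N) as [[_ [_ Hbad]] _]. apply Hbad, H; auto; lra.
Qed.

(** The real part of the integral of [g dz] along the boundary of [[a, b] x [c, d]];
    its vanishing for every [lam * g] is Goursat's lemma for [g]. *)
Definition circulation (g : C -> C) (a b c d : R) : R :=
  RInt (fun x => Re (g (x, c)) - Re (g (x, d))) a b
  - RInt (fun y => Im (g (b, y)) - Im (g (a, y))) c d.

Lemma Im_le_Cmod (z : C) : Rabs (Im z) <= Cmod z.
Proof.
  rewrite <- (Rabs_Ropp (Im z)), <- re_mult_Ci, <- (Rmult_1_r (Cmod z)), <- Cmod_Ci, <- Cmod_mult.
  apply re_le_Cmod.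
Qed.

Lemma Cmod_vert (x y y' : R) : Cmod ((x, y) - (x, y')) = Rabs (y - y').
Proof.
  replace ((x, y) - (x, y'))%C with (Ci * RtoC (y - y'))%C
    by (apply injective_projections; simpl; ring).
  rewrite Cmod_mult, Cmod_Ci, Cmod_R. ring.
Qed.

Lemma Cmod_horiz (x x' y : R) : Cmod ((x, y) - (x', y)) = Rabs (x - x').
Proof.
  rewrite <- Cmod_R. f_equal. apply injective_projections; simpl; ring.
Qed.

Lemma continuous_of_eps (f : R -> R) (x : R) :
  (forall eps, 0 < eps -> exists delta, 0 < delta /\
     forall y, Rabs (y - x) < delta -> Rabs (f y - f x) < eps) ->
  continuous f x.
Proof.
  intros H. apply (filterlim_locally (F := locally x) f (f x)). intros e.
  destruct (H e (cond_pos e)) as [d [Hd HH]].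
  exists (mkposreal d Hd). intros y Hy. apply HH, Hy.
Qed.

Lemma Ccont_horiz (g : C -> C) (x y : R) :
  Ccont g (x, y) -> continuous (fun t => Re (g (t, y))) x.
Proof.
  intros H. apply continuous_of_eps. intros e He. destruct (H e He) as [d [Hd HH]].
  exists d; split; [easy|]. intros t Ht.
  apply Rle_lt_trans with (Cmod (g (t, y) - g (x, y))).
  - exact (re_le_Cmod (g (t, y) - g (x, y))).
  - apply HH. now rewrite Cmod_horiz.
Qed.

Lemma Ccont_vert (g : C -> C) (x y : R) :
  Ccont g (x, y) -> continuous (fun t => Im (g (x, t))) y.
Proof.
  intros H. apply continuous_of_eps. intros e He. destruct (H e He) as [d [Hd HH]].
  exists d; split; [easy|]. intros t Ht.
  apply Rle_lt_trans with (Cmod (g (x, t) - g (x, y))).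
  - exact (Im_le_Cmod (g (x, t) - g (x, y))).
  - apply HH. now rewrite Cmod_vert.
Qed.

Lemma RInt_sub (f g : R -> R) (a b : R) :
  ex_RInt f a b -> ex_RInt g a b ->
  RInt (fun x => f x - g x) a b = RInt f a b - RInt g a b.
Proof. exact (RInt_minus (V := R_CompleteNormedModule) f g a b). Qed.

Lemma RInt_near_const (f : R -> R) (a b k e : R) :
  a <= b -> ex_RInt f a b -> (forall x, a <= x <= b -> Rabs (f x - k) <= e) ->
  Rabs (RInt f a b - k * (b - a)) <= e * (b - a).
Proof.
  intros Hab Hf H.
  assert (Hk : forall r : R, RInt (fun _ => r) a b = r * (b - a)).
  { intros r. rewrite RInt_const. unfold scal; simpl; unfold mult; simpl. ring. }
  assert (H1 : RInt (fun _ => k - e) a b <= RInt f a b).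
  { apply RInt_le; auto; [apply ex_RInt_const|].
    intros x Hx. specialize (H x). apply Rabs_le_between in H; lra. }
  assert (H2 : RInt f a b <= RInt (fun _ => k + e) a b).
  { apply RInt_le; auto; [apply ex_RInt_const|].
    intros x Hx. specialize (H x). apply Rabs_le_between in H; lra. }
  rewrite Hk in H1, H2. apply Rabs_le; lra.
Qed.

Section Goursat.

Variables (g : C -> C) (a0 b0 c0 d0 : R).
Hypothesis Hg : forall x y, a0 <= x <= b0 -> c0 <= y <= d0 ->
  exists l, has_Cderiv g (x, y) l.

Lemma ex_RInt_horiz (a b y : R) :
  a0 <= a -> a <= b -> b <= b0 -> c0 <= y <= d0 ->
  ex_RInt (fun x => Re (g (x, y))) a b.
Proof.
  intros. apply (ex_RInt_continuous (V := R_CompleteNormedModule)).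
  intros x Hx. rewrite Rmin_left, Rmax_right in Hx by lra.
  destruct (Hg x y) as [l Hl]; [lra|easy|].
  now apply Ccont_horiz, (has_Cderiv_cont g _ l).
Qed.

Lemma ex_RInt_vert (x c d : R) :
  a0 <= x <= b0 -> c0 <= c -> c <= d -> d <= d0 ->
  ex_RInt (fun y => Im (g (x, y))) c d.
Proof.
  intros. apply (ex_RInt_continuous (V := R_CompleteNormedModule)).
  intros y Hy. rewrite Rmin_left, Rmax_right in Hy by lra.
  destruct (Hg x y) as [l Hl]; [easy|lra|].
  now apply Ccont_vert, (has_Cderiv_cont g _ l).
Qed.

(** Chasles' relation needs one integral per side. The definition keeps opposite sides under one
    integral because the local estimate and the periodic case compare their integrands pointwise. *)
Lemma circulation_sides (a b c d : R) :
  a0 <= a -> a <= b -> b <= b0 -> c0 <= c -> c <= d -> d <= d0 ->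
  circulation g a b c d =
    RInt (fun x => Re (g (x, c))) a b - RInt (fun x => Re (g (x, d))) a b
    - (RInt (fun y => Im (g (b, y))) c d - RInt (fun y => Im (g (a, y))) c d).
Proof.
  intros. unfold circulation.
  rewrite (RInt_sub (fun x => Re (g (x, c)))) by (apply ex_RInt_horiz; lra).
  rewrite (RInt_sub (fun y => Im (g (b, y)))) by (apply ex_RInt_vert; lra).
  reflexivity.
Qed.

Lemma circulation_split_horiz (a m b c d : R) :
  a0 <= a -> a <= m -> m <= b -> b <= b0 -> c0 <= c -> c <= d -> d <= d0 ->
  circulation g a b c d = circulation g a m c d + circulation g m b c d.
Proof.
  intros. rewrite !circulation_sides by lra.
  rewrite <- (RInt_Chasles (V := R_CompleteNormedModule) (fun x => Re (g (x, c))) a m b)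
    by (apply ex_RInt_horiz; lra).
  rewrite <- (RInt_Chasles (V := R_CompleteNormedModule) (fun x => Re (g (x, d))) a m b)
    by (apply ex_RInt_horiz; lra).
  unfold plus; simpl. ring.
Qed.

Lemma circulation_split_vert (a b c m d : R) :
  a0 <= a -> a <= b -> b <= b0 -> c0 <= c -> c <= m -> m <= d -> d <= d0 ->
  circulation g a b c d = circulation g a b c m + circulation g a b m d.
Proof.
  intros. rewrite !circulation_sides by lra.
  rewrite <- (RInt_Chasles (V := R_CompleteNormedModule) (fun y => Im (g (a, y))) c m d)
    by (apply ex_RInt_vert; lra).
  rewrite <- (RInt_Chasles (V := R_CompleteNormedModule) (fun y => Im (g (b, y))) c m d)
    by (apply ex_RInt_vert; lra).
  unfold plus; simpl. ring.
Qed.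

(** Near a point, the constant and linear parts of [g] cancel between opposite sides.
    The bound [width^2 + height^2] is divided by 4 under bisection, as the area is, so
    that no control of the aspect ratio is needed. *)
Lemma circulation_local (x y eps : R) :
  0 < eps -> a0 <= x <= b0 -> c0 <= y <= d0 ->
  exists delta, 0 < delta /\ forall a b c d,
    a <= x <= b -> c <= y <= d -> b - a < delta -> d - c < delta ->
    a0 <= a -> b <= b0 -> c0 <= c -> d <= d0 ->
    Rabs (circulation g a b c d) <= eps * ((b - a) ^ 2 + (d - c) ^ 2).
Proof.
  intros He Hx Hy. destruct (Hg x y Hx Hy) as [l Hl].
  (* The remainder on the boundary is at most [eps / 4 * s], its difference across opposite sides at
     most [eps / 2 * s], and the integrals together at most [eps / 2 * s ^ 2]. *)
  destruct (Hl (eps / 4)) as [delta [Hd H]]; [lra|].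
  exists (delta / 2); split; [lra|].
  intros a b c d Hax Hcy Hw Hh Ha Hb Hc Hdd.
  set (s := (b - a) + (d - c)).
  set (rho := fun z : C => (g z - g (x, y) - l * (z - (x, y)))%C).
  assert (Hrho : forall x' y', a <= x' <= b -> c <= y' <= d ->
                   Cmod (rho (x', y')) <= eps / 4 * s).
  { intros x' y' Hx' Hy'.
    assert (Hm : Cmod ((x', y') - (x, y)) <= s).
    { replace ((x', y') - (x, y))%C with (((x', y') - (x, y')) + ((x, y') - (x, y)))%C by ring.
      eapply Rle_trans; [apply Cmod_triangle|].
      rewrite Cmod_horiz, Cmod_vert. unfold s.
      apply Rplus_le_compat; apply Rabs_le; lra. }
    eapply Rle_trans; [apply H|]; [unfold s in Hm; lra|].
    apply Rmult_le_compat_l; lra. }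
  (* Through either pair of sides the linear part contributes [Im l] times the area; the two
     contributions cancel in [circulation]. *)
  assert (Hre : Rabs (RInt (fun x => Re (g (x, c)) - Re (g (x, d))) a b
                      - (Im l * (d - c)) * (b - a)) <= (eps / 2 * s) * (b - a)).
  { apply RInt_near_const; [lra| |].
    - apply (ex_RInt_minus (V := R_CompleteNormedModule)); apply ex_RInt_horiz; lra.
    - intros t Ht.
      replace (Re (g (t, c)) - Re (g (t, d)) - Im l * (d - c))
        with (Re (rho (t, c) - rho (t, d))).
      + eapply Rle_trans; [apply re_le_Cmod|].
        eapply Rle_trans; [apply Cmod_triangle|]. rewrite Cmod_opp.
        pose proof (Hrho t c Ht). pose proof (Hrho t d Ht). lra.
      + unfold rho. destruct l as [l1 l2], (g (t, c)), (g (t, d)), (g (x, y)).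
        simpl. ring. }
  assert (Him : Rabs (RInt (fun y => Im (g (b, y)) - Im (g (a, y))) c d
                      - (Im l * (b - a)) * (d - c)) <= (eps / 2 * s) * (d - c)).
  { apply RInt_near_const; [lra| |].
    - apply (ex_RInt_minus (V := R_CompleteNormedModule)); apply ex_RInt_vert; lra.
    - intros t Ht.
      replace (Im (g (b, t)) - Im (g (a, t)) - Im l * (b - a))
        with (Im (rho (b, t) - rho (a, t))).
      + eapply Rle_trans; [apply Im_le_Cmod|].
        eapply Rle_trans; [apply Cmod_triangle|]. rewrite Cmod_opp.
        pose proof (fun H => Hrho a t H Ht). pose proof (fun H => Hrho b t H Ht). lra.
      + unfold rho. destruct l as [l1 l2], (g (b, t)), (g (a, t)), (g (x, y)).
        simpl. ring. }
  unfold circulation.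
  apply Rabs_le_between in Hre, Him.
  apply Rle_trans with (eps / 2 * s * (b - a) + eps / 2 * s * (d - c)).
  - apply Rabs_le; lra.
  - unfold s.
    (* This square gives (u + v)^2 <= 2 (u^2 + v^2) for the width u and the height v. *)
    assert (0 <= eps * ((b - a) - (d - c)) ^ 2) by (apply Rmult_le_pos; [lra|apply pow2_ge_0]).
    nra.
Qed.

Lemma goursat : a0 <= b0 -> c0 <= d0 -> circulation g a0 b0 c0 d0 = 0.
Proof.
  intros Hab Hcd.
  assert (H : forall eps, 0 < eps ->
    Rabs (circulation g a0 b0 c0 d0) <= eps * ((b0 - a0) ^ 2 + (d0 - c0) ^ 2)).
  { intros eps He.
    (* The containment is part of [P] because bisection quantifies over all rectangles, while [g] is
       controlled only on the given one. *)
    set (P := fun a b c d => a0 <= a -> b <= b0 -> c0 <= c -> d <= d0 ->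
       Rabs (circulation g a b c d) <= eps * ((b - a) ^ 2 + (d - c) ^ 2)).
    assert (HP : P a0 b0 c0 d0); [|apply HP; lra].
    apply (rectangle_bisection P); auto; unfold P.
    - intros a b c d H1 H2 Q1 Q2 Q3 Q4 Ha Hb Hc Hd.
      rewrite (circulation_split_horiz a ((a + b) / 2) b c d) by lra.
      rewrite (circulation_split_vert a _ c ((c + d) / 2) d) by lra.
      rewrite (circulation_split_vert _ b c ((c + d) / 2) d) by lra.
      specialize (Q1 ltac:(lra) ltac:(lra) ltac:(lra) ltac:(lra)).
      specialize (Q2 ltac:(lra) ltac:(lra) ltac:(lra) ltac:(lra)).
      specialize (Q3 ltac:(lra) ltac:(lra) ltac:(lra) ltac:(lra)).
      specialize (Q4 ltac:(lra) ltac:(lra) ltac:(lra) ltac:(lra)).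
      apply Rabs_le_between in Q1, Q2, Q3, Q4. apply Rabs_le.
      replace (eps * ((b - a) ^ 2 + (d - c) ^ 2)) with
        (4 * (eps * (((a + b) / 2 - a) ^ 2 + ((c + d) / 2 - c) ^ 2))) by field.
      replace (b - (a + b) / 2) with ((a + b) / 2 - a) in * by field.
      replace (d - (c + d) / 2) with ((c + d) / 2 - c) in * by field.
      lra.
    - intros x y Hx Hy.
      destruct (circulation_local x y eps He Hx Hy) as [delta [Hd H]].
      exists delta; split; [easy|]. intros; now apply H. }
  destruct (Req_dec (circulation g a0 b0 c0 d0) 0) as [->|Hne]; [easy|exfalso].
  apply Rabs_pos_lt in Hne.
  set (A := (b0 - a0) ^ 2 + (d0 - c0) ^ 2) in *.
  assert (HA : 0 <= A).
  { unfold A. pose proof (pow2_ge_0 (b0 - a0)). pose proof (pow2_ge_0 (d0 - c0)). lra. }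
  set (J := Rabs (circulation g a0 b0 c0 d0)) in *.
  (* With this [eps] the bound is below [J / 2]; the summand 1 covers [A = 0]. *)
  specialize (H (J / (2 * (A + 1)))).
  assert (Hq : 0 < J / (2 * (A + 1))) by (apply Rdiv_lt_0_compat; lra).
  specialize (H Hq).
  assert (J / (2 * (A + 1)) * (2 * (A + 1)) = J) by (field; lra).
  nra.
Qed.

End Goursat.

(** * The maximum principle *)

Lemma derivable_pt_lim_remainder (f : R -> R) (l eps : R) :
  derivable_pt_lim f 0 l -> 0 < eps -> exists delta, 0 < delta /\
    forall h, Rabs h < delta -> Rabs (f h - f 0 - l * h) <= eps * Rabs h.
Proof.
  intros H He. destruct (H eps He) as [d Hd].
  exists d; split; [apply cond_pos|]. intros h Hh.
  destruct (Req_dec h 0) as [->|Hne].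
  - replace (f 0 - f 0 - l * 0) with 0 by ring. rewrite Rabs_R0; lra.
  - specialize (Hd h Hne Hh). rewrite Rplus_0_l in Hd.
    replace (f h - f 0 - l * h) with (((f h - f 0) / h - l) * h) by (field; easy).
    rewrite Rabs_mult. apply Rmult_le_compat_r; [apply Rabs_pos|lra].
Qed.

Lemma Cmod_le_Re_Im (z : C) : Cmod z <= Rabs (Re z) + Rabs (Im z).
Proof.
  replace z with (RtoC (Re z) + Ci * RtoC (Im z))%C at 1
    by (apply injective_projections; unfold Re, Im; simpl; ring).
  eapply Rle_trans; [apply Cmod_triangle|].
  rewrite Cmod_mult, Cmod_Ci, !Cmod_R. lra.
Qed.

(** * The complex exponential *)

Lemma Cmod_Cexp (z : C) : Cmod (Cexp z) = exp (Re z).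
Proof.
  unfold Cexp, Cmod; simpl.
  replace (_ + _) with (exp (Re z) ^ 2 * (Rsqr (sin (Im z)) + Rsqr (cos (Im z))))
    by (unfold Rsqr; ring).
  rewrite sin2_cos2, Rmult_1_r. apply sqrt_pow2, Rlt_le, exp_pos.
Qed.

Lemma Cexp_plus (z w : C) : Cexp (z + w) = (Cexp z * Cexp w)%C.
Proof.
  unfold Cexp, Cmult; simpl. unfold Re, Im; simpl.
  rewrite exp_plus, cos_plus, sin_plus. f_equal; ring.
Qed.

Lemma Cexp_0 : Cexp 0 = 1.
Proof.
  unfold Cexp; simpl. rewrite exp_0, cos_0, sin_0. apply injective_projections; simpl; ring.
Qed.

Lemma has_Cderiv_Cexp_0 : has_Cderiv Cexp 0 1.
Proof.
  intros eps He.
  (* The 9 counts the error terms in units of [e * m]: 1 from the remainder of exp, 3 from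
     [exp x * (cos y - 1)], 4 from [(exp x - 1) * sin y], 1 from the remainder of sin. *)
  set (e := Rmin 1 (eps / 9)).
  assert (He0 : 0 < e) by (apply Rmin_pos; lra).
  assert (He1 : e <= 1) by apply Rmin_l.
  assert (He2 : e <= eps / 9) by apply Rmin_r.
  destruct (derivable_pt_lim_remainder exp 1 e) as [d1 [Hd1 H1]]; auto.
  { rewrite <- exp_0. apply derivable_pt_lim_exp. }
  destruct (derivable_pt_lim_remainder cos 0 e) as [d2 [Hd2 H2]]; auto.
  { replace 0 with (- sin 0) at 2 by (rewrite sin_0; ring). apply derivable_pt_lim_cos. }
  destruct (derivable_pt_lim_remainder sin 1 e) as [d3 [Hd3 H3]]; auto.
  { rewrite <- cos_0. apply derivable_pt_lim_sin. }
  rewrite exp_0 in H1. rewrite cos_0 in H2. rewrite sin_0 in H3.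
  exists (Rmin e (Rmin d1 (Rmin d2 d3))). split; [repeat (apply Rmin_pos; auto)|].
  intros w Hw. rewrite Cexp_0.
  replace (w - 0)%C with w in * by ring.
  apply Rmin_Rgt in Hw as [Hw0 Hw]. apply Rmin_Rgt in Hw as [Hw1 Hw].
  apply Rmin_Rgt in Hw as [Hw2 Hw3].
  pose proof (re_le_Cmod w) as Hx. pose proof (Im_le_Cmod w) as Hy.
  set (x := Re w) in *. set (y := Im w) in *. set (m := Cmod w) in *.
  specialize (H1 x). specialize (H2 y). specialize (H3 y).
  pose proof (Rabs_pos x). pose proof (Rabs_pos y).
  assert (E1 : Rabs (exp x - 1 - 1 * x) <= e * m)
    by (eapply Rle_trans; [apply H1; lra|]; apply Rmult_le_compat_l; lra).
  assert (E2 : Rabs (cos y - 1) <= e * m).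
  { replace (cos y - 1) with (cos y - 1 - 0 * y) by ring.
    eapply Rle_trans; [apply H2; lra|]; apply Rmult_le_compat_l; lra. }
  assert (E3 : Rabs (sin y - y) <= e * m).
  { replace (sin y - y) with (sin y - 0 - 1 * y) by ring.
    eapply Rle_trans; [apply H3; lra|]; apply Rmult_le_compat_l; lra. }
  assert (Hem : e * m <= m) by (rewrite <- (Rmult_1_l m) at 2; apply Rmult_le_compat_r; lra).
  assert (E4 : Rabs (exp x - 1) <= 2 * m).
  { replace (exp x - 1) with ((exp x - 1 - 1 * x) + x) by ring.
    eapply Rle_trans; [apply Rabs_triang|]. lra. }
  assert (E5 : Rabs (sin y) <= 2 * m).
  { replace (sin y) with ((sin y - y) + y) by ring.
    eapply Rle_trans; [apply Rabs_triang|]. lra. }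
  assert (E6 : Rabs (exp x) <= 3).
  { replace (exp x) with ((exp x - 1) + 1) by ring.
    eapply Rle_trans; [apply Rabs_triang|]. rewrite (Rabs_right 1); lra. }
  eapply Rle_trans; [apply Cmod_le_Re_Im|].
  replace (Re (Cexp w - 1 - 1 * w)) with ((exp x - 1 - 1 * x) + exp x * (cos y - 1))
    by (unfold x, y, Cexp, Re; simpl; ring).
  replace (Im (Cexp w - 1 - 1 * w)) with ((exp x - 1) * sin y + (sin y - y))
    by (unfold x, y, Cexp, Im; simpl; ring).
  eapply Rle_trans; [apply Rplus_le_compat; apply Rabs_triang|].
  rewrite !Rabs_mult.
  assert (Rabs (exp x) * Rabs (cos y - 1) <= 3 * (e * m))
    by (apply Rmult_le_compat; auto using Rabs_pos).
  assert (Rabs (exp x - 1) * Rabs (sin y) <= (2 * m) * (2 * m))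
    by (apply Rmult_le_compat; auto using Rabs_pos).
  assert (m * m <= e * m) by (apply Rmult_le_compat_r; lra).
  assert (e * m <= eps / 9 * m) by (apply Rmult_le_compat_r; lra).
  lra.
Qed.

Lemma has_Cderiv_Cexp (z : C) : has_Cderiv Cexp z (Cexp z).
Proof.
  apply (has_Cderiv_ext_loc (fun w => Cexp z * Cexp (w - z))%C _ _ _ 1); [lra| |].
  - intros w _. rewrite <- Cexp_plus. f_equal. ring.
  - apply (has_Cderiv_eq _ _ (0 * Cexp (z - z) + Cexp z * (1 * (1 + 0)))%C).
    + apply (has_Cderiv_mult (fun _ => Cexp z) (fun w => Cexp (w - z))%C);
        [apply has_Cderiv_const|].
      apply (has_Cderiv_comp Cexp (fun w => w - z)%C z 1 (1 + 0)%C).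
      * replace (z - z)%C with (RtoC 0) by ring. apply has_Cderiv_Cexp_0.
      * apply (has_Cderiv_plus (fun w => w) (fun _ => - z)%C);
          [apply has_Cderiv_id|apply has_Cderiv_const].
    + ring.
Qed.

(** * Circle means and the maximum principle at the centre *)

Lemma RInt_zero (a b : R) : RInt (fun _ => 0) a b = 0.
Proof. rewrite RInt_const. unfold scal; simpl; unfold mult; simpl. ring. Qed.

(** In the logarithmic coordinate [w], [z = c + e^w], a circle centred at [c]
    is a vertical segment of length [2 PI], and by periodicity the two horizontal
    sides of a rectangle of this height do not contribute. *)
Lemma circle_mean_Im (f : C -> C) (c : C) (s t : R) :
  s <= t ->
  (forall z, Cmod (z - c) <= exp t -> exists l, has_Cderiv f z l) ->
  RInt (fun y => Im (f (c + Cexp (t, y))%C) - Im (f (c + Cexp (s, y))%C)) 0 (2 * PI) = 0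
  /\ ex_RInt (fun y => Im (f (c + Cexp (t, y))%C) - Im (f (c + Cexp (s, y))%C)) 0 (2 * PI).
Proof.
  intros Hst Hf.
  pose proof PI_RGT_0 as Hpi.
  set (g := fun w => f (c + Cexp w)%C).
  assert (Hg : forall x y, s <= x <= t -> 0 <= y <= 2 * PI ->
                 exists l, has_Cderiv g (x, y) l).
  { intros x y Hx _. destruct (Hf (c + Cexp (x, y))%C) as [l Hl].
    - replace (c + Cexp (x, y) - c)%C with (Cexp (x, y)) by ring.
      rewrite Cmod_Cexp. simpl.
      destruct (proj2 Hx) as [H|H]; [left; now apply exp_increasing|right; now rewrite <- H].
    - eexists. apply (has_Cderiv_comp f (fun w => c + Cexp w)%C); [exact Hl|].
      apply has_Cderiv_plus; [apply has_Cderiv_const|apply has_Cderiv_Cexp]. }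
  assert (HJ : circulation g s t 0 (2 * PI) = 0) by (apply goursat; auto; lra).
  unfold circulation in HJ.
  rewrite (RInt_ext _ (fun _ => 0)) in HJ.
  - rewrite RInt_zero in HJ. split.
    + change (RInt (fun y => Im (g (t, y)) - Im (g (s, y))) 0 (2 * PI) = 0). lra.
    + apply (ex_RInt_minus (V := R_CompleteNormedModule));
        apply (ex_RInt_vert g s t 0 (2 * PI)); auto; lra.
  - intros x _. unfold g.
    replace (Cexp (x, 2 * PI)) with (Cexp (x, 0)); [apply Rminus_diag|].
    unfold Cexp; simpl. now rewrite cos_2PI, sin_2PI, cos_0, sin_0.
Qed.

(** Circle means are compared for imaginary parts only, so the central value is first turned onto
    the positive imaginary axis. *)
Lemma exists_rotation (z : C) : z <> 0 ->
  exists lam : C, Cmod lam = 1 /\ Im (lam * z)%C = Cmod z.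
Proof.
  intros Hz. pose proof (proj1 (Cmod_gt_0 z) Hz) as Hm.
  assert (Hm0 : RtoC (Cmod z) <> 0) by (intros E; apply RtoC_inj in E; lra).
  exists (Ci * Cconj z / RtoC (Cmod z))%C; split.
  - rewrite Cmod_div, Cmod_mult, Cmod_Ci, Cmod_conj, Cmod_R, Rabs_right by (auto; lra).
    field; lra.
  - replace (Ci * Cconj z / Cmod z * z)%C with (Ci * (z * Cconj z / Cmod z))%C by (field; auto).
    rewrite <- Cmod2_conj.
    replace (Ci * (RtoC (Cmod z ^ 2) / RtoC (Cmod z)))%C with (Ci * RtoC (Cmod z))%C.
    + simpl. ring.
    + rewrite RtoC_pow. field; auto.
Qed.

(** The imaginary part of [lam * f] has the same mean over the circle of radius [r] and over a small
    circle about [c]. On the former it is at most [M], on the latter it is close to [Cmod (f c)]. *)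
Lemma maximum_principle_centre (f : C -> C) (c : C) (r M : R) :
  0 < r ->
  (forall z, Cmod (z - c) <= r -> exists l, has_Cderiv f z l) ->
  (forall z, Cmod (z - c) = r -> Cmod (f z) <= M) ->
  Cmod (f c) <= M.
Proof.
  intros Hr Hf HM. apply Rnot_lt_le; intros Hlt.
  assert (H0 : f c <> 0).
  { intros E. rewrite E, Cmod_0 in Hlt.
    assert (0 <= M); [|lra].
    eapply Rle_trans; [apply Cmod_ge_0|apply (HM (c + RtoC r)%C)].
    replace (c + r - c)%C with (RtoC r) by ring. rewrite Cmod_R. apply Rabs_right; lra. }
  destruct (exists_rotation _ H0) as [lam [Hlam Hrot]].
  (* The gap is [2 * e]; continuity at [c] uses up one [e], and the other makes the integrand at
     most [- e]. *)
  set (e := (Cmod (f c) - M) / 2).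
  assert (He : 0 < e) by (unfold e; lra).
  destruct (Hf c) as [l Hl]; [rewrite Cmod_minus_diag; lra|].
  destruct (has_Cderiv_cont f c l Hl e He) as [d [Hd Hcont]].
  (* Logarithms of the two radii; the small circle has radius at most [d / 2], inside the disc where
     [f] is close to [f c]. *)
  set (t := ln r). set (s := Rmin t (ln (d / 2))).
  assert (Ht : exp t = r) by now apply exp_ln.
  assert (Hs : exp s < d).
  { apply Rle_lt_trans with (exp (ln (d / 2))).
    - destruct (Rmin_r t (ln (d / 2))) as [H|H];
        [left; now apply exp_increasing|right; unfold s; now rewrite H].
    - rewrite exp_ln; lra. }
  destruct (circle_mean_Im (fun z => lam * f z)%C c s t) as [HI Hex].
  { apply Rmin_l. }
  { intros z Hz. rewrite Ht in Hz. destruct (Hf z Hz) as [l' Hl'].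
    eexists. apply has_Cderiv_mult; [apply has_Cderiv_const|exact Hl']. }
  pose proof PI_RGT_0 as Hpi.
  assert (HI' : RInt (fun y => Im (lam * f (c + Cexp (t, y)))%C - Im (lam * f (c + Cexp (s, y)))%C)
            0 (2 * PI) <= RInt (fun _ => - e) 0 (2 * PI)).
  { apply RInt_le; [lra|exact Hex|apply ex_RInt_const|].
    intros y Hy.
    assert (A : Im (lam * f (c + Cexp (t, y)))%C <= M).
    { eapply Rle_trans; [apply Rle_abs|]. eapply Rle_trans; [apply Im_le_Cmod|].
      rewrite Cmod_mult, Hlam, Rmult_1_l. apply HM.
      replace (c + Cexp (t, y) - c)%C with (Cexp (t, y)) by ring.
      now rewrite Cmod_Cexp. }
    assert (B : Cmod (f c) - e <= Im (lam * f (c + Cexp (s, y)))%C).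
    { assert (B : Rabs (Im (lam * (f (c + Cexp (s, y)) - f c))%C) <= e).
      { eapply Rle_trans; [apply Im_le_Cmod|].
        rewrite Cmod_mult, Hlam, Rmult_1_l. apply Rlt_le, Hcont.
        replace (c + Cexp (s, y) - c)%C with (Cexp (s, y)) by ring.
        now rewrite Cmod_Cexp. }
      replace (lam * (f (c + Cexp (s, y)) - f c))%C
        with (lam * f (c + Cexp (s, y)) + - (lam * f c))%C in B by ring.
      rewrite im_plus, im_opp, Hrot in B. apply Rabs_le_between in B. lra. }
    unfold e in *. lra. }
  rewrite HI, RInt_const in HI'. unfold scal in HI'; simpl in HI'; unfold mult in HI'; simpl in HI'.
  assert (0 < 2 * PI * e) by (apply Rmult_lt_0_compat; lra). lra.
Qed.

Lemma analytic_on_has_Cderiv (U : C -> Prop) (f : C -> C) :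
  analytic_on U f <-> forall z, U z -> exists l, has_Cderiv f z l.
Proof.
  split; intros H z Hz; destruct (H z Hz) as [l Hl]; exists l;
    now apply has_Cderiv_is_derive.
Qed.

(** * Moebius maps of the disc *)

Definition moebius (b z : C) : C := ((z + b) / (1 + Cconj b * z))%C.

(** The source of all mapping properties used: disc into disc, circle into circle, and the
    transformation of the Poisson kernel. *)
Lemma moebius_identity (b z : C) :
  Cmod (1 + Cconj b * z) ^ 2 - Cmod (z + b) ^ 2 = (1 - Cmod b ^ 2) * (1 - Cmod z ^ 2).
Proof.
  rewrite !Cmod2_alt. destruct b, z. unfold Re, Im; simpl. ring.
Qed.

Lemma moebius_den (b z : C) : Cmod b < 1 -> Cmod z <= 1 -> (1 + Cconj b * z <> 0)%C.
Proof.
  intros Hb Hz. apply Cmod_gt_0.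
  pose proof (Cmod_plus_ge 1 (Cconj b * z)) as H.
  rewrite Cmod_1, Cmod_mult, Cmod_conj in H.
  assert (Cmod b * Cmod z <= Cmod b * 1) by (apply Rmult_le_compat_l; [apply Cmod_ge_0|easy]).
  lra.
Qed.

Lemma one_minus_Cmod2_moebius (b z : C) : Cmod b < 1 -> Cmod z <= 1 ->
  1 - Cmod (moebius b z) ^ 2 =
  (1 - Cmod b ^ 2) * (1 - Cmod z ^ 2) / Cmod (1 + Cconj b * z) ^ 2.
Proof.
  intros Hb Hz. pose proof (moebius_den b z Hb Hz) as Hd.
  unfold moebius. rewrite Cmod_div, <- moebius_identity by easy.
  apply Cmod_gt_0 in Hd. field; lra.
Qed.

Lemma sq_lt_1 (x : R) : 0 <= x -> (x < 1 <-> 0 < 1 - x ^ 2).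
Proof. intros; split; intros; nra. Qed.

Lemma Cmod_moebius_lt (b z : C) : Cmod b < 1 -> Cmod z < 1 -> Cmod (moebius b z) < 1.
Proof.
  intros Hb Hz. apply sq_lt_1; [apply Cmod_ge_0|].
  rewrite one_minus_Cmod2_moebius by lra.
  apply sq_lt_1 in Hb, Hz; try apply Cmod_ge_0.
  apply Rdiv_lt_0_compat; [now apply Rmult_lt_0_compat|].
  apply pow_lt, Cmod_gt_0, moebius_den; apply sq_lt_1 in Hb, Hz; try apply Cmod_ge_0; lra.
Qed.

Lemma Cmod_moebius_eq (b z : C) : Cmod b < 1 -> Cmod z = 1 -> Cmod (moebius b z) = 1.
Proof.
  intros Hb Hz. pose proof (one_minus_Cmod2_moebius b z Hb ltac:(lra)) as H.
  rewrite Hz in H. unfold Rdiv in H.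
  replace ((1 - Cmod b ^ 2) * (1 - 1 ^ 2)) with 0 in H by ring.
  rewrite Rmult_0_l in H. pose proof (Cmod_ge_0 (moebius b z)). nra.
Qed.

Lemma has_Cderiv_moebius (b z : C) : (1 + Cconj b * z <> 0)%C ->
  has_Cderiv (moebius b) z
    ((1 - Cconj b * b) / ((1 + Cconj b * z) * (1 + Cconj b * z)))%C.
Proof.
  intros Hd. unfold moebius, Cdiv.
  assert (H1 : has_Cderiv (fun w => w + b)%C z (1 + 0)).
  { apply has_Cderiv_plus; [apply has_Cderiv_id|apply has_Cderiv_const]. }
  assert (H2 : has_Cderiv (fun w => 1 + Cconj b * w)%C z (0 + (0 * z + Cconj b * 1))).
  { apply has_Cderiv_plus; [apply has_Cderiv_const|].
    apply (has_Cderiv_mult (fun _ => Cconj b) (fun w => w));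
      [apply has_Cderiv_const|apply has_Cderiv_id]. }
  apply (has_Cderiv_inv (fun w => 1 + Cconj b * w)%C) in H2; [|easy].
  eapply has_Cderiv_eq; [exact (has_Cderiv_mult _ _ _ _ _ H1 H2)|].
  cbv beta. field. easy.
Qed.

Lemma moebius_opp_moebius (b z : C) : Cmod b < 1 -> (1 + Cconj b * z <> 0)%C ->
  moebius (- b) (moebius b z) = z.
Proof.
  intros Hb Hd.
  assert (Hb' : (1 - Cconj b * b <> 0)%C).
  { pose proof (moebius_den (- b) b) as H. rewrite Cmod_opp, Copp_conj in H.
    specialize (H Hb ltac:(lra)).
    now replace (1 - Cconj b * b)%C with (1 + - Cconj b * b)%C by ring. }
  unfold moebius. rewrite Copp_conj.
  field. split; [easy|].
  replace (1 + Cconj b * z + - Cconj b * (z + b))%C with (1 - Cconj b * b)%C by ring. easy.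
Qed.

Lemma moebius_0 (b : C) : moebius b 0 = b.
Proof.
  unfold moebius. replace (1 + Cconj b * 0)%C with (RtoC 1) by ring. field.
Qed.

(** The map z -> [r * moebius b z] with b = a / r takes the unit disc and its circle into those of
    radius [r], and takes 0 to [a]; so the case of the centre suffices. *)
Lemma maximum_principle (f : C -> C) (r M : R) (a : C) :
  0 < r ->
  (forall z, Cmod z <= r -> exists l, has_Cderiv f z l) ->
  (forall z, Cmod z = r -> Cmod (f z) <= M) ->
  Cmod a < r -> Cmod (f a) <= M.
Proof.
  intros Hr Hf HM Ha.
  assert (Hr0 : RtoC r <> 0) by (intros E; apply RtoC_inj in E; lra).
  assert (Hmr : Cmod r = r) by (rewrite Cmod_R; apply Rabs_right; lra).
  set (b := (a / r)%C).
  assert (Hb : Cmod b < 1).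
  { unfold b. rewrite Cmod_div, Hmr by easy.
    apply (Rmult_lt_reg_r r); [lra|]. unfold Rdiv. rewrite Rmult_assoc, Rinv_l; lra. }
  replace a with (r * moebius b 0)%C by (rewrite moebius_0; unfold b; field; easy).
  assert (Hle : forall z, Cmod z <= 1 -> Cmod (r * moebius b z) <= r).
  { intros z Hz. rewrite Cmod_mult, Hmr. rewrite <- (Rmult_1_r r) at 2.
    apply Rmult_le_compat_l; [lra|].
    destruct Hz as [Hz|Hz].
    - now apply Rlt_le, Cmod_moebius_lt.
    - now apply Req_le, Cmod_moebius_eq. }
  apply (maximum_principle_centre (fun z => f (r * moebius b z))%C 0 1 M); [lra| |].
  - intros z Hz. replace (z - 0)%C with z in Hz by ring.
    destruct (Hf _ (Hle z Hz)) as [l Hl].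
    eexists. apply (has_Cderiv_comp f (fun w => r * moebius b w)%C); [exact Hl|].
    apply has_Cderiv_mult; [apply has_Cderiv_const|].
    apply has_Cderiv_moebius, moebius_den; auto.
  - intros z Hz. replace (z - 0)%C with z in Hz by ring.
    apply HM. rewrite Cmod_mult, Hmr, Cmod_moebius_eq by auto. ring.
Qed.

(** * An exceptional point in the maximum principle, and Schwarz's lemma *)

Lemma ex_has_Cderiv_pow (f : C -> C) (z l : C) (n : nat) :
  has_Cderiv f z l -> exists l', has_Cderiv (fun w => f w ^ n)%C z l'.
Proof.
  intros H. induction n as [|n [l' IH]]; simpl.
  - exists 0. apply has_Cderiv_const.
  - eexists. apply has_Cderiv_mult; [exact H|exact IH].
Qed.

Lemma pow_bounded_le_1 (x B : R) : (forall n, x ^ n <= B) -> x <= 1.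
Proof.
  intros H. apply Rnot_lt_le; intros Hx.
  destruct (Pow_x_infinity x) with (b := B + 1) as [N HN].
  { rewrite Rabs_right; lra. }
  specialize (HN N (Nat.le_refl N)). specialize (H N).
  rewrite Rabs_right in HN; [lra|]. apply Rle_ge, pow_le; lra.
Qed.

(** A maximum principle for a function that is only known to be continuous at
    one point: [q ^ n * (z - p)] is differentiable at [p] too, and the factor
    [z - p] becomes negligible after taking [n]-th roots. *)
Lemma maximum_principle_punctured (q : C -> C) (p : C) (r M : R) (a : C) :
  0 < r -> 0 < M -> Ccont q p -> Cmod p <= r ->
  (forall z, Cmod z <= r -> z <> p -> exists l, has_Cderiv q z l) ->
  (forall z, Cmod z = r -> Cmod (q z) <= M) ->
  Cmod a < r -> a <> p -> Cmod (q a) <= M.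
Proof.
  intros Hr HM Hq Hp Hd HMr Ha Hap.
  assert (Hap' : 0 < Cmod (a - p)).
  { apply Cmod_gt_0. intros E. apply Hap. replace a with (a - p + p)%C by ring. rewrite E. ring. }
  assert (Hn : forall n, (Cmod (q a) / M) ^ n <= 2 * r / Cmod (a - p)).
  { intros n.
    assert (Hmax : Cmod (q a ^ n * (a - p)) <= M ^ n * (2 * r)).
    { apply (maximum_principle (fun z => q z ^ n * (z - p))%C r); auto.
      - intros z Hz. destruct (Ceq_dec z p) as [->|Hne].
        (* At [p] the function [q ^ n] is itself the continuous slope of the product. *)
        + exists (q p ^ n)%C.
          apply (has_Cderiv_slope _ (fun w => q w ^ n)%C p 1); [lra|now apply Ccont_pow|].
          intros w _. ring.
        + destruct (Hd z Hz Hne) as [l Hl].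
          destruct (ex_has_Cderiv_pow q z l n Hl) as [l' Hl'].
          eexists. apply has_Cderiv_mult; [exact Hl'|].
          apply has_Cderiv_plus; [apply has_Cderiv_id|apply has_Cderiv_const].
      - intros z Hz. rewrite Cmod_mult, Cmod_pow.
        apply Rmult_le_compat; try apply Cmod_ge_0; [apply pow_le, Cmod_ge_0| |].
        + apply pow_incr. split; [apply Cmod_ge_0|auto].
        + eapply Rle_trans; [apply Cmod_triangle|]. rewrite Cmod_opp. lra. }
    rewrite Cmod_mult, Cmod_pow in Hmax.
    assert (HMn : 0 < M ^ n) by now apply pow_lt.
    unfold Rdiv at 1. rewrite Rpow_mult_distr, pow_inv.
    apply (Rmult_le_reg_r (M ^ n * Cmod (a - p))); [now apply Rmult_lt_0_compat|].
    replace (Cmod (q a) ^ n * / M ^ n * (M ^ n * Cmod (a - p)))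
      with (Cmod (q a) ^ n * Cmod (a - p)) by (field; lra).
    replace (2 * r / Cmod (a - p) * (M ^ n * Cmod (a - p))) with (M ^ n * (2 * r))
      by (field; lra).
    easy. }
  apply pow_bounded_le_1 in Hn.
  apply (Rmult_le_compat_r M) in Hn; [|lra].
  replace (Cmod (q a) / M * M) with (Cmod (q a)) in Hn by (field; lra). lra.
Qed.

Lemma slope_differentiable (f q : C -> C) (p z l : C) :
  (forall w, (f w - f p = q w * (w - p))%C) -> z <> p -> has_Cderiv f z l ->
  exists l', has_Cderiv q z l'.
Proof.
  intros Hq Hz Hl.
  assert (Hne : forall w, w <> p -> (w - p <> 0)%C).
  { intros w Hw E. apply Hw. replace w with (w - p + p)%C by ring. rewrite E. ring. }
  eexists.
  apply (has_Cderiv_ext_loc (fun w => (f w + - f p) * / (w + - p))%C q z _ (Cmod (z - p))).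
  - now apply Cmod_gt_0, Hne.
  - intros w Hw. change (((f w - f p) * / (w - p))%C = q w). rewrite Hq. field.
    apply Hne. intros ->. rewrite Cmod_minus_sym in Hw. lra.
  - apply has_Cderiv_mult.
    + apply has_Cderiv_plus; [exact Hl|apply has_Cderiv_const].
    + apply (has_Cderiv_inv (fun w => w + - p)%C); [|now apply Hne].
      apply has_Cderiv_plus; [apply has_Cderiv_id|apply has_Cderiv_const].
Qed.

(** The slope of [f] at 0 is f(z) / z, at most 1 / r on the circle of radius r < 1. As it is only
    continuous at 0, the punctured maximum principle carries this bound inside, and r tends to 1. *)
Lemma schwarz (f : C -> C) :
  (forall z, Cmod z < 1 -> exists l, has_Cderiv f z l) ->
  (forall z, Cmod z < 1 -> Cmod (f z) < 1) -> f 0 = 0 ->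
  forall z, Cmod z < 1 -> Cmod (f z) <= Cmod z.
Proof.
  intros Hf Hdisc H0 z Hz.
  destruct (Ceq_dec z 0) as [->|Hz0]; [rewrite H0; lra|].
  destruct (Hf 0) as [l Hl]; [rewrite Cmod_0; lra|].
  destruct (slope_of_has_Cderiv f 0 l Hl) as [q [_ [Hqc Hq]]].
  assert (Hfq : forall w, Cmod (f w) = Cmod (q w) * Cmod w).
  { intros w. rewrite <- Cmod_mult. f_equal.
    replace (q w * w)%C with (q w * (w - 0))%C by ring. rewrite <- Hq, H0. ring. }
  assert (Hr : forall r, Cmod z < r < 1 -> Cmod (q z) <= / r).
  { intros r Hr. pose proof (Cmod_ge_0 z).
    apply (maximum_principle_punctured q 0 r); try lra; auto.
    - apply Rinv_0_lt_compat; lra.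
    - rewrite Cmod_0; lra.
    - intros w Hw Hw0. destruct (Hf w) as [l' Hl']; [lra|].
      now apply (slope_differentiable f q 0 w l').
    - intros w Hw. apply (Rmult_le_reg_r r); [lra|]. rewrite Rinv_l by lra.
      rewrite <- Hw, <- Hfq. apply Rlt_le, Hdisc. lra. }
  assert (Hq1 : Cmod (q z) <= 1).
  { apply Rnot_lt_le; intros Hlt.
    (* Any radius below 1 that exceeds both [Cmod z] and [/ Cmod (q z)] contradicts the bound by
       [/ r]. *)
    set (r := (Rmax (Cmod z) (/ Cmod (q z)) + 1) / 2).
    pose proof (Rmax_l (Cmod z) (/ Cmod (q z))).
    pose proof (Rmax_r (Cmod z) (/ Cmod (q z))).
    assert (Hinv : / Cmod (q z) < 1) by (rewrite <- Rinv_1; apply Rinv_lt_contravar; lra).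
    assert (Rmax (Cmod z) (/ Cmod (q z)) < 1) by now apply Rmax_lub_lt.
    specialize (Hr r ltac:(unfold r; lra)).
    assert (/ Cmod (q z) < r) by (unfold r; lra).
    assert (0 < / Cmod (q z)) by (apply Rinv_0_lt_compat; lra).
    apply (Rmult_le_compat_r r) in Hr; [|lra]. rewrite Rinv_l in Hr by lra.
    assert (Hc : Cmod (q z) * / Cmod (q z) < Cmod (q z) * r) by (apply Rmult_lt_compat_l; lra).
    rewrite Rinv_r in Hc; lra. }
  rewrite Hfq. rewrite <- (Rmult_1_l (Cmod z)) at 2.
  apply Rmult_le_compat_r; [apply Cmod_ge_0|lra].
Qed.

(** * Injective analytic maps *)

Lemma continuity_pt_Cmod_path (g : C -> C) (gamma : R -> C) (x : R) :
  continuous (fun t => Re (gamma t)) x -> continuous (fun t => Im (gamma t)) x ->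
  Ccont g (gamma x) -> continuity_pt (fun t => Cmod (g (gamma t))) x.
Proof.
  intros H1 H2 Hg. apply continuity_pt_filterlim.
  apply (continuous_of_eps (fun t => Cmod (g (gamma t)))). intros e He.
  destruct (Hg e He) as [d [Hd H]].
  assert (Hd2 : 0 < d / 2) by lra.
  destruct (proj1 (filterlim_locally (F := locally x) _ _) H1 (mkposreal _ Hd2)) as [d1 Hd1].
  destruct (proj1 (filterlim_locally (F := locally x) _ _) H2 (mkposreal _ Hd2)) as [d2 Hd2'].
  exists (Rmin d1 d2); split; [apply Rmin_pos; apply cond_pos|].
  intros t Ht. apply Rmin_Rgt in Ht as [Ht1 Ht2].
  specialize (Hd1 t Ht1). specialize (Hd2' t Ht2).
  change (Rabs (Re (gamma t) - Re (gamma x)) < d / 2) in Hd1.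
  change (Rabs (Im (gamma t) - Im (gamma x)) < d / 2) in Hd2'.
  assert (Hm : Cmod (gamma t - gamma x) < d).
  { eapply Rle_lt_trans; [apply Cmod_le_Re_Im|].
    change (Rabs (Re (gamma t) - Re (gamma x)) + Rabs (Im (gamma t) - Im (gamma x)) < d). lra. }
  specialize (H _ Hm).
  pose proof (Cmod_plus_ge (g (gamma t)) (g (gamma x) - g (gamma t))) as A.
  replace (g (gamma t) + (g (gamma x) - g (gamma t)))%C with (g (gamma x)) in A by ring.
  rewrite (Cmod_minus_sym (g (gamma x))) in A.
  pose proof (Cmod_plus_ge (g (gamma x)) (g (gamma t) - g (gamma x))) as B.
  replace (g (gamma x) + (g (gamma t) - g (gamma x)))%C with (g (gamma t)) in B by ring.
  apply Rabs_def1; lra.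
Qed.

Lemma path_lower_bound (g : C -> C) (gamma : R -> C) (a b : R) :
  a <= b ->
  (forall t, a <= t <= b -> continuous (fun t => Re (gamma t)) t /\
     continuous (fun t => Im (gamma t)) t /\ Ccont g (gamma t) /\ g (gamma t) <> 0) ->
  exists m, 0 < m /\ forall t, a <= t <= b -> m <= Cmod (g (gamma t)).
Proof.
  intros Hab H.
  destruct (continuity_ab_min (fun t => Cmod (g (gamma t))) a b Hab) as [t0 [Hmin Ht0]].
  - intros t Ht. destruct (H t Ht) as [H1 [H2 [H3 _]]]. now apply continuity_pt_Cmod_path.
  - exists (Cmod (g (gamma t0))). split; [|easy]. now apply Cmod_gt_0, H.
Qed.

(** The circle is the union of the graphs of sqrt(r^2 - t^2) and its negative over [- r, r], so the
    minimum of a continuous function on an interval suffices, once for each half. *)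
Lemma circle_lower_bound (g : C -> C) (c : C) (r : R) :
  0 < r ->
  (forall z, Cmod (z - c) = r -> Ccont g z /\ g z <> 0) ->
  exists m, 0 < m /\ forall z, Cmod (z - c) = r -> m <= Cmod (g z).
Proof.
  intros Hr H.
  assert (Hs : forall t, - r <= t <= r -> 0 <= r ^ 2 - t ^ 2) by (intros; nra).
  assert (Hhalf : forall s, s ^ 2 = 1 -> exists m, 0 < m /\ forall t, - r <= t <= r ->
            m <= Cmod (g (c + (t, (s * sqrt (r ^ 2 - t ^ 2))%R))%C)).
  { intros s Hs1.
    apply (path_lower_bound g (fun t => c + (t, (s * sqrt (r ^ 2 - t ^ 2))%R))%C); [lra|].
    intros t Ht. split; [|split].
    - apply continuous_of_eps. intros e He. exists e; split; [easy|].
      intros y Hy. simpl. replace (fst c + y - (fst c + t)) with (y - t) by ring. easy.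
    - apply (continuous_plus (fun _ => Im c) (fun t => s * sqrt (r ^ 2 - t ^ 2)));
        [apply continuous_const|].
      apply (continuous_scal_r (K := R_AbsRing) s (fun t => sqrt (r ^ 2 - t ^ 2))).
      apply (continuous_comp (fun t => r ^ 2 - t ^ 2) sqrt); [|apply continuous_sqrt].
      apply (ex_derive_continuous (K := R_AbsRing) (V := R_NormedModule)). now auto_derive.
    - apply H.
      replace (c + (t, (s * sqrt (r ^ 2 - t ^ 2))%R) - c)%C with (t, (s * sqrt (r ^ 2 - t ^ 2))%R)
        by (apply injective_projections; simpl; ring).
      unfold Cmod; cbn [fst snd].
      rewrite Rpow_mult_distr, Hs1, pow2_sqrt by now apply Hs.
      replace (t ^ 2 + 1 * (r ^ 2 - t ^ 2)) with (r ^ 2) by ring. apply sqrt_pow2; lra. }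
  destruct (Hhalf 1) as [m1 [Hm1 H1]]; [ring|].
  destruct (Hhalf (- 1)) as [m2 [Hm2 H2]]; [ring|].
  exists (Rmin m1 m2); split; [now apply Rmin_pos|].
  intros z Hz.
  set (x := Re (z - c)). set (y := Im (z - c)).
  assert (Hxy : x ^ 2 + y ^ 2 = r ^ 2) by (unfold x, y; now rewrite <- Cmod2_alt, Hz).
  assert (Hx : - r <= x <= r) by (apply Rabs_le_between; rewrite <- Hz; apply re_le_Cmod).
  assert (Hz' : z = (c + (x, y))%C).
  { unfold x, y. destruct z, c; apply injective_projections; simpl; ring. }
  destruct (Rle_dec 0 y) as [Hy|Hy].
  - apply Rle_trans with m1; [apply Rmin_l|]. specialize (H1 x Hx).
    replace (1 * sqrt (r ^ 2 - x ^ 2)) with y in H1; [now rewrite Hz'|].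
    rewrite <- Hxy. replace (x ^ 2 + y ^ 2 - x ^ 2) with (y ^ 2) by ring.
    rewrite sqrt_pow2; lra.
  - apply Rle_trans with m2; [apply Rmin_r|]. specialize (H2 x Hx).
    replace (- 1 * sqrt (r ^ 2 - x ^ 2)) with y in H2; [now rewrite Hz'|].
    rewrite <- Hxy. replace (x ^ 2 + y ^ 2 - x ^ 2) with ((- y) ^ 2) by ring.
    rewrite sqrt_pow2; lra.
Qed.

Lemma Cminus_0_r (z : C) : (z - 0)%C = z.
Proof. ring. Qed.

(** The real and imaginary parts of t -> f(z + t (w - z)) have derivative 0 on [0, 1]. *)
Lemma Cderiv_zero_segment (f : C -> C) (z w : C) :
  (forall t : R, 0 <= t <= 1 -> has_Cderiv f (z + t * (w - z))%C 0) -> f z = f w.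
Proof.
  intros H.
  assert (Hlim : forall t, 0 <= t <= 1 -> forall e, 0 < e -> exists d, 0 < d /\
    forall h, Rabs h < d ->
      Cmod (f (z + RtoC (t + h) * (w - z)) - f (z + t * (w - z)))%C <= e * Rabs h).
  { intros t Ht e He. pose proof (Cmod_ge_0 (w - z)) as Hm.
    set (m := Cmod (w - z)) in *.
    (* Dividing by [m + 1] instead of [m] includes the case [z = w]. *)
    destruct (H t Ht (e / (m + 1))) as [d [Hd HH]]; [apply Rdiv_lt_0_compat; lra|].
    exists (d / (m + 1)); split; [apply Rdiv_lt_0_compat; lra|].
    intros h Hh.
    assert (E : (z + RtoC (t + h) * (w - z) - (z + t * (w - z)))%C = (h * (w - z))%C)
      by (rewrite RtoC_plus; ring).
    assert (Hmod : Cmod (h * (w - z)) = Rabs h * m) by (rewrite Cmod_mult, Cmod_R; easy).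
    specialize (HH (z + RtoC (t + h) * (w - z))%C). rewrite E, Hmod in HH.
    replace (0 * (h * (w - z)))%C with (RtoC 0) in HH by ring.
    pose proof (Rabs_pos h).
    assert (Hhd : Rabs h * (m + 1) < d).
    { apply (Rmult_lt_compat_r (m + 1)) in Hh; [|lra].
      replace (d / (m + 1) * (m + 1)) with d in Hh by (field; lra). easy. }
    assert (Hle : Rabs h * m <= Rabs h * (m + 1)) by (apply Rmult_le_compat_l; lra).
    specialize (HH ltac:(lra)).
    rewrite (Cminus_0_r (_ - _)%C) in HH.
    eapply Rle_trans; [exact HH|].
    apply Rle_trans with (e / (m + 1) * (Rabs h * (m + 1))).
    - apply Rmult_le_compat_l; [|easy]. apply Rlt_le, Rdiv_lt_0_compat; lra.
    - apply Req_le; field; lra. }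
  assert (Hproj : forall pr : C -> R, (forall u v, pr (u - v)%C = pr u - pr v) ->
            (forall u, Rabs (pr u) <= Cmod u) -> pr (f z) = pr (f w)).
  { intros pr Hpr Hle.
    pose proof (eq_is_derive (fun t : R => pr (f (z + t * (w - z))%C)) 0 1) as E.
    cbv beta in E.
    replace (z + 0 * (w - z))%C with z in E by ring.
    replace (z + 1 * (w - z))%C with w in E by ring.
    apply E; [|lra]. intros t Ht. apply is_derive_Reals.
    intros e He. destruct (Hlim t Ht (e / 2)) as [d [Hd HH]]; [lra|].
    exists (mkposreal d Hd). intros h Hh0 Hh. specialize (HH h Hh).
    rewrite <- Hpr, Rminus_0_r. unfold Rdiv. rewrite Rabs_mult, Rabs_inv.
    apply Rabs_pos_lt in Hh0.
    apply (Rmult_lt_reg_r (Rabs h)); [easy|].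
    rewrite Rmult_assoc, Rinv_l, Rmult_1_r by lra.
    eapply Rle_lt_trans; [apply Hle|]. eapply Rle_lt_trans; [exact HH|].
    apply Rmult_lt_compat_r; lra. }
  apply injective_projections; apply Hproj.
  - intros [] []; reflexivity.
  - apply re_le_Cmod.
  - intros [] []; reflexivity.
  - apply Im_le_Cmod.
Qed.

(** For [f' a <> 0] the quotient [(z - a) / (f z - f a)] has no zero or pole, so the
    maximum principle bounds it at [0], uniformly in [a] near [0]. If [f' 0 = 0] this
    leaves no room for points [a] with [f' a <> 0] near [0], and [f] is constant there. *)
Lemma injective_deriv_neq_0_at_0 (f : C -> C) (r : R) (l : C) :
  0 < r ->
  (forall z, Cmod z <= r -> exists l, has_Cderiv f z l) ->
  (forall z w, Cmod z <= r -> Cmod w <= r -> f z = f w -> z = w) ->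
  has_Cderiv f 0 l -> l <> 0.
Proof.
  intros Hr Hf Hinj Hl0 ->.
  assert (H0r : Cmod 0 <= r) by (rewrite Cmod_0; lra).
  destruct (circle_lower_bound (fun z => f z - f 0)%C 0 r Hr) as [m [Hm Hcirc]].
  { intros z Hz. replace (z - 0)%C with z in Hz by ring. split.
    - destruct (Hf z ltac:(lra)) as [l Hl]. apply has_Cderiv_cont in Hl.
      now apply Ccont_plus; [|apply Ccont_const].
    - intros E. assert (z = 0).
      { apply Hinj; try lra. replace (f z) with (f z - f 0 + f 0)%C by ring. rewrite E. ring. }
      subst z. rewrite Cmod_0 in Hz. lra. }
  (* For [a] this close to 0, [f a] is within [m / 2] of [f 0], so [f z - f a] has modulus at least
     [m / 2] on the circle. *)
  destruct (has_Cderiv_cont f 0 0 Hl0 (m / 2)) as [d1 [Hd1 H1]]; [lra|].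
  (* The maximum principle will give [Cmod (s 0) >= m / (4 * r)] for the slope [s] at [a]; half of
     this value is enough for the contradiction. *)
  destruct (Hl0 (m / (8 * r))) as [d2 [Hd2 H2]]; [apply Rdiv_lt_0_compat; lra|].
  set (eta := Rmin r (Rmin d1 d2)).
  assert (Heta : 0 < eta) by (unfold eta; repeat (apply Rmin_pos; auto)).
  assert (Hcrit : forall a, Cmod a < eta -> has_Cderiv f a 0).
  { intros a Ha. destruct (Ceq_dec a 0) as [->|Ha0]; [easy|].
    apply Rmin_Rgt in Ha as [Har Ha]. apply Rmin_Rgt in Ha as [Ha1 Ha2].
    destruct (Hf a) as [l Hl]; [lra|].
    destruct (Ceq_dec l 0) as [->|Hl']; [easy|exfalso].
    destruct (slope_of_has_Cderiv f a l Hl) as [s [Hsa [Hsc Hs]]].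
    assert (Hs0 : forall w, Cmod w <= r -> s w <> 0).
    { intros w Hw E. destruct (Ceq_dec w a) as [->|Hne]; [congruence|].
      apply Hne, Hinj; try lra. replace (f w) with (f w - f a + f a)%C by ring.
      rewrite Hs, E. ring. }
    replace (a - 0)%C with a in * by ring.
    specialize (H1 a). specialize (H2 a). replace (a - 0)%C with a in * by ring.
    specialize (H1 Ha1). specialize (H2 Ha2).
    replace (f a - f 0 - 0 * a)%C with (f a - f 0)%C in H2 by ring.
    assert (Hmax : Cmod (/ s 0) <= 2 * r / (m / 2)).
    { apply (maximum_principle_punctured (fun w => / s w)%C a r); auto; try lra.
      - apply Rdiv_lt_0_compat; lra.
      - apply Ccont_inv; [easy|]. apply Hs0; lra.
      - intros z Hz Hza. destruct (Hf z Hz) as [lz Hlz].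
        destruct (slope_differentiable f s a z lz Hs Hza Hlz) as [l' Hl'2].
        eexists. apply has_Cderiv_inv; [exact Hl'2|auto].
      - intros z Hz.
        assert (Hza : Cmod (z - a) <= 2 * r).
        { eapply Rle_trans; [apply Cmod_triangle|]. rewrite Cmod_opp. lra. }
        assert (Hfz : m / 2 <= Cmod (f z - f a)).
        { specialize (Hcirc z). replace (z - 0)%C with z in Hcirc by ring.
          specialize (Hcirc Hz).
          pose proof (Cmod_plus_ge (f z - f 0) (- (f a - f 0))) as A.
          rewrite Cmod_opp in A.
          replace (f z - f 0 + - (f a - f 0))%C with (f z - f a)%C in A by ring. lra. }
        assert (Hsz : s z <> 0) by (apply Hs0; lra).
        rewrite Hs, Cmod_mult in Hfz. rewrite Cmod_inv by easy.
        apply Cmod_gt_0 in Hsz.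
        apply (Rmult_le_reg_r (Cmod (s z) * (m / 2))); [apply Rmult_lt_0_compat; lra|].
        replace (/ Cmod (s z) * (Cmod (s z) * (m / 2))) with (m / 2) by (field; lra).
        replace (2 * r / (m / 2) * (Cmod (s z) * (m / 2))) with (Cmod (s z) * (2 * r))
          by (field; lra).
        eapply Rle_trans; [exact Hfz|]. apply Rmult_le_compat_l; lra.
      - rewrite Cmod_0. easy. }
    assert (Hs00 : s 0 <> 0) by auto.
    rewrite Cmod_inv in Hmax by easy.
    assert (Heq : Cmod (f a - f 0) = Cmod (s 0) * Cmod a).
    { rewrite Cmod_minus_sym, Hs, Cmod_mult, Cmod_minus_sym. do 2 f_equal. ring. }
    rewrite Heq in H2.
    apply Cmod_gt_0 in Ha0. apply Cmod_gt_0 in Hs00.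
    apply Rmult_le_reg_r in H2; [|easy].
    apply (Rmult_le_compat_r (Cmod (s 0) * (m / 2))) in Hmax;
      [|apply Rmult_le_pos; lra].
    replace (/ Cmod (s 0) * (Cmod (s 0) * (m / 2))) with (m / 2) in Hmax by (field; lra).
    replace (2 * r / (m / 2) * (Cmod (s 0) * (m / 2))) with (Cmod (s 0) * (2 * r)) in Hmax
      by (field; lra).
    apply (Rmult_le_compat_r (2 * r)) in H2; [|lra].
    replace (m / (8 * r) * (2 * r)) with (m / 4) in H2 by (field; lra). lra. }
  assert (Hc : Cmod (RtoC (eta / 2)) = eta / 2) by (rewrite Cmod_R; apply Rabs_right; lra).
  assert (Her : eta <= r) by apply Rmin_l.
  assert (E : RtoC 0 = RtoC (eta / 2)).
  { apply Hinj; [easy|lra|].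
    apply Cderiv_zero_segment. intros t Ht. apply Hcrit.
    replace (0 + t * (RtoC (eta / 2) - 0))%C with (t * RtoC (eta / 2))%C by ring.
    rewrite Cmod_mult, Hc, Cmod_R, Rabs_right by lra.
    apply Rle_lt_trans with (1 * (eta / 2)); [apply Rmult_le_compat_r; lra|lra]. }
  apply RtoC_inj in E. lra.
Qed.

Lemma closed_ball_in_disc (z : C) (r : R) (w : C) :
  r < 1 - Cmod z -> Cmod (w - z) <= r -> Cmod w < 1.
Proof.
  intros Hr Hw. replace w with (w - z + z)%C by ring.
  eapply Rle_lt_trans; [apply Cmod_triangle|]. lra.
Qed.

Lemma injective_deriv_neq_0 (f : C -> C) (z l : C) :
  (forall z, Cmod z < 1 -> exists l, has_Cderiv f z l) ->
  (forall z w, Cmod z < 1 -> Cmod w < 1 -> f z = f w -> z = w) ->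
  Cmod z < 1 -> has_Cderiv f z l -> l <> 0.
Proof.
  intros Hf Hinj Hz Hl.
  set (r := (1 - Cmod z) / 2).
  assert (Hin : forall w, Cmod w <= r -> Cmod (z + w) < 1).
  { intros w Hw. apply (closed_ball_in_disc z r); [unfold r; lra|].
    now replace (z + w - z)%C with w by ring. }
  assert (Hd : forall w l, has_Cderiv f (z + w) l -> has_Cderiv (fun w => f (z + w))%C w l).
  { intros w l' Hl'. apply (has_Cderiv_eq _ _ (l' * (0 + 1))%C); [|ring].
    apply (has_Cderiv_comp f (fun w => z + w)%C); [easy|].
    apply has_Cderiv_plus; [apply has_Cderiv_const|apply has_Cderiv_id]. }
  apply (injective_deriv_neq_0_at_0 (fun w => f (z + w))%C r l); [unfold r; lra| | |].
  - intros w Hw. destruct (Hf (z + w)%C (Hin w Hw)) as [l' Hl']. exists l'. auto.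
  - intros w w' Hw Hw' E. apply Hinj in E; auto.
    replace w with (z + w - z)%C by ring. rewrite E. ring.
  - apply Hd. now replace (z + 0)%C with z by ring.
Qed.

(** If a value [w] close to [f z] were omitted on a closed disc about [z], then 1 / (f - w) would be
    differentiable there and larger at the centre than on the circle. *)
Lemma injective_open (f : C -> C) (z : C) (eps : R) :
  (forall z, Cmod z < 1 -> exists l, has_Cderiv f z l) ->
  (forall z w, Cmod z < 1 -> Cmod w < 1 -> f z = f w -> z = w) ->
  Cmod z < 1 -> 0 < eps ->
  exists delta, 0 < delta /\ forall w, Cmod (w - f z) < delta ->
    exists z', Cmod z' < 1 /\ Cmod (z' - z) < eps /\ f z' = w.
Proof.
  intros Hf Hinj Hz He.
  set (r := Rmin (eps / 2) ((1 - Cmod z) / 2)).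
  assert (Hr : 0 < r) by (apply Rmin_pos; lra).
  assert (Hre : r < eps) by (eapply Rle_lt_trans; [apply Rmin_l|]; lra).
  assert (Hrz : r < 1 - Cmod z) by (eapply Rle_lt_trans; [apply Rmin_r|]; lra).
  destruct (circle_lower_bound (fun w => f w - f z)%C z r Hr) as [m [Hm Hcirc]].
  { intros w Hw. assert (Hw1 : Cmod w < 1) by (apply (closed_ball_in_disc z r); lra).
    split.
    - destruct (Hf w Hw1) as [l Hl]. apply has_Cderiv_cont in Hl.
      now apply Ccont_plus; [|apply Ccont_const].
    - intros E. assert (w = z).
      { apply Hinj; auto. replace (f w) with (f w - f z + f z)%C by ring. rewrite E. ring. }
      subst w. rewrite Cmod_minus_diag in Hw. lra. }
  (* Then [Cmod (f z - w)] is below [m / 2], while [f - w] has modulus at least [m / 2] on the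
     circle. *)
  exists (m / 2); split; [lra|]. intros w Hw.
  apply NNPP; intros Hno.
  assert (Hne : forall z', Cmod (z' - z) <= r -> (f z' - w <> 0)%C).
  { intros z' Hz' E. apply Hno. exists z'. split; [|split].
    - now apply (closed_ball_in_disc z r).
    - lra.
    - replace (f z') with (f z' - w + w)%C by ring. rewrite E. ring. }
  assert (Hz0 : (f z - w <> 0)%C) by (apply Hne; rewrite Cmod_minus_diag; lra).
  assert (Hmax : Cmod (/ (f z - w)) <= / (m / 2)).
  { apply (maximum_principle_centre (fun z' => / (f z' - w))%C z r); auto.
    - intros z' Hz'.
      destruct (Hf z') as [l Hl]; [now apply (closed_ball_in_disc z r)|].
      eexists. apply (has_Cderiv_inv (fun z' => f z' - w)%C); [|auto].
      apply has_Cderiv_plus; [exact Hl|apply has_Cderiv_const].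
    - intros z' Hz'. rewrite Cmod_inv by (apply Hne; lra).
      apply Rinv_le_contravar; [lra|].
      specialize (Hcirc z' Hz').
      pose proof (Cmod_plus_ge (f z' - f z) (- (w - f z))) as A.
      rewrite Cmod_opp in A.
      replace (f z' - f z + - (w - f z))%C with (f z' - w)%C in A by ring. lra. }
  rewrite Cmod_inv in Hmax by easy. rewrite Cmod_minus_sym in Hw.
  apply Cmod_gt_0 in Hz0.
  apply Rinv_lt_contravar in Hw; [lra|]. apply Rmult_lt_0_compat; lra.
Qed.

(** * The automorphisms of the disc *)

(** Openness makes the inverse continuous. If [s] is the slope of [f] at g(w), the slope of the
    inverse at [w] is 1 / s(g(w')), continuous because [s] has no zero. *)
Lemma Aut_disc_inverse (f : C -> C) :
  Aut_disc f -> exists g : C -> C,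
    (forall w, Cmod w < 1 -> exists l, has_Cderiv g w l) /\
    (forall w, Cmod w < 1 -> Cmod (g w) < 1 /\ f (g w) = w) /\
    (forall z, Cmod z < 1 -> g (f z) = z).
Proof.
  intros [Hf [Hmap [Hinj Hsurj]]]. rewrite analytic_on_has_Cderiv in Hf.
  unfold unit_disc in *.
  (* Off the disc no preimage is claimed and the chosen value is arbitrary. *)
  set (g := fun w => epsilon (inhabits w) (fun z => Cmod z < 1 /\ f z = w)).
  assert (Hg : forall w, Cmod w < 1 -> Cmod (g w) < 1 /\ f (g w) = w).
  { intros w Hw. apply (epsilon_spec (inhabits w) (fun z => Cmod z < 1 /\ f z = w)). auto. }
  assert (Hgf : forall z, Cmod z < 1 -> g (f z) = z).
  { intros z Hz. destruct (Hg (f z) (Hmap z Hz)). now apply Hinj. }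
  exists g; split; [|split]; auto.
  intros w Hw. destruct (Hg w Hw) as [Hz Hfz]. set (z := g w) in *.
  destruct (Hf z Hz) as [l Hl].
  assert (Hl0 : l <> 0) by now apply (injective_deriv_neq_0 f z l).
  destruct (slope_of_has_Cderiv f z l Hl) as [s [Hsz [Hsc Hs]]].
  assert (Hgc : Ccont g w).
  { intros e He. destruct (injective_open f z e Hf Hinj Hz He) as [d [Hd H]].
    exists d; split; [easy|]. intros w' Hw'. rewrite <- Hfz in Hw'.
    destruct (H w' Hw') as [z' [Hz'1 [Hz'2 <-]]]. rewrite Hgf by easy. easy. }
  exists (/ s (g w))%C.
  apply (has_Cderiv_slope g (fun w' => / s (g w'))%C w (1 - Cmod w)); [lra| |].
  - apply (Ccont_inv (fun w' => s (g w'))).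
    + now apply Ccont_comp.
    + fold z. congruence.
  - intros w' Hw'.
    assert (Hw'1 : Cmod w' < 1).
    { replace w' with (w' - w + w)%C by ring.
      eapply Rle_lt_trans; [apply Cmod_triangle|]. lra. }
    destruct (Hg w' Hw'1) as [Hz' Hfz']. set (z' := g w') in *.
    (* A zero of the slope off [z] contradicts injectivity; at [z] the slope is the derivative
       [l]. *)
    assert (Hs0 : s z' <> 0).
    { intros E. destruct (Ceq_dec z' z) as [->|Hne]; [congruence|].
      apply Hne, Hinj; auto. replace (f z') with (f z' - f z + f z)%C by ring.
      rewrite Hs, E. ring. }
    fold z. replace (w' - w)%C with (f z' - f z)%C by congruence. rewrite Hs. now field.
Qed.

(** If the derivative [l] were nonzero, a step in the direction g(z) / l would push the modulus
    above 1 to first order. *)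
Lemma unimodular_deriv_0 (g : C -> C) (z l : C) (r : R) :
  0 < r -> Cmod (g z) = 1 -> (forall w, Cmod (w - z) < r -> Cmod (g w) <= 1) ->
  has_Cderiv g z l -> l = 0.
Proof.
  intros Hr Hz Hle Hl. apply NNPP; intros Hl0.
  pose proof (proj1 (Cmod_gt_0 l) Hl0) as Hml.
  destruct (Hl (Cmod l / 2)) as [d [Hd H]]; [lra|].
  (* Chosen so that [l * h = t * g z] with [h] inside both radii. The remainder is at most [t / 2],
     whence a modulus of at least [1 + t / 2]. *)
  set (t := Rmin r d / 2 * Cmod l).
  assert (Hrd : 0 < Rmin r d) by now apply Rmin_pos.
  assert (Ht : 0 < t) by (apply Rmult_lt_0_compat; lra).
  set (h := (t * g z / l)%C).
  assert (Hh : Cmod h = Rmin r d / 2).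
  { unfold h. rewrite Cmod_div, Cmod_mult, Cmod_R, Hz, Rabs_right by (auto; lra).
    unfold t. field. lra. }
  assert (Eh : (z + h - z)%C = h) by ring.
  pose proof (Rmin_l r d). pose proof (Rmin_r r d).
  specialize (Hle (z + h)%C). specialize (H (z + h)%C).
  rewrite Eh, Hh in Hle, H.
  specialize (Hle ltac:(lra)). specialize (H ltac:(lra)).
  replace (l * h)%C with (t * g z)%C in H by (unfold h; field; easy).
  pose proof (Cmod_plus_ge ((1 + t) * g z) (g (z + h)%C - g z - t * g z)) as A.
  replace ((1 + t) * g z + (g (z + h)%C - g z - t * g z))%C with (g (z + h)%C) in A by ring.
  rewrite Cmod_mult, Hz, <- RtoC_plus, Cmod_R, Rabs_right in A by lra.
  replace (Cmod l / 2 * (Rmin r d / 2)) with (t / 2) in H by (unfold t; field).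
  lra.
Qed.

(** Schwarz's lemma for [f] and for its inverse gives |f(z)| = |z|. The slope f(z) / z then has
    modulus 1 off 0, hence derivative 0 there, hence is constant. *)
Lemma Aut_disc_fixing_0 (f : C -> C) :
  Aut_disc f -> f 0 = 0 ->
  exists lam, Cmod lam = 1 /\ forall z, Cmod z < 1 -> f z = (lam * z)%C.
Proof.
  intros HA H0. destruct (Aut_disc_inverse f HA) as [g [Hg1 [Hg2 Hg3]]].
  destruct HA as [Hf [Hmap _]]. rewrite analytic_on_has_Cderiv in Hf.
  unfold unit_disc in *.
  assert (H01 : Cmod 0 < 1) by (rewrite Cmod_0; lra).
  assert (Hmod : forall z, Cmod z < 1 -> Cmod (f z) = Cmod z).
  { intros z Hz. apply Rle_antisym.
    - now apply schwarz.
    - rewrite <- (Hg3 z Hz) at 1. apply schwarz; auto.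
      + intros w Hw. now apply Hg2.
      + rewrite <- H0 at 1. now apply Hg3. }
  destruct (Hf 0 H01) as [l Hl].
  destruct (slope_of_has_Cderiv f 0 l Hl) as [s [_ [Hsc Hs]]].
  assert (Hfs : forall z, f z = (s z * z)%C).
  { intros z. replace (s z * z)%C with (s z * (z - 0))%C by ring. rewrite <- Hs, H0. ring. }
  assert (Hs1 : forall z, Cmod z < 1 -> z <> 0 -> Cmod (s z) = 1).
  { intros z Hz Hz0. apply Cmod_gt_0 in Hz0. specialize (Hmod z Hz).
    rewrite Hfs, Cmod_mult in Hmod. apply (Rmult_eq_reg_r (Cmod z)); lra. }
  assert (Hds : forall z, Cmod z < 1 -> z <> 0 -> has_Cderiv s z 0).
  { intros z Hz Hz0. destruct (Hf z Hz) as [lz Hlz].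
    destruct (slope_differentiable f s 0 z lz Hs Hz0 Hlz) as [l' Hl'].
    replace (RtoC 0) with l'; [easy|].
    apply (unimodular_deriv_0 s z l' (Rmin (1 - Cmod z) (Cmod z))); auto.
    - apply Rmin_pos; [lra|]. now apply Cmod_gt_0.
    - intros w Hw. apply Rmin_Rgt in Hw as [Hw1 Hw2]. apply Req_le, Hs1.
      + replace w with (w - z + z)%C by ring.
        eapply Rle_lt_trans; [apply Cmod_triangle|]. lra.
      + intros ->. rewrite Cmod_minus_sym, Cminus_0_r in Hw2. lra. }
  assert (Hcst : forall z, Cmod z < 1 -> s z = s 0).
  { intros z Hz. destruct (Ceq_dec z 0) as [->|Hz0]; [easy|].
    (* At 0 the slope is known only to be continuous, so the segments stop short of 0 and the value
       [s 0] is reached in the limit, along every ray. *)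
    assert (Hray : forall t : R, 0 < t <= 1 -> s (t * z)%C = s z).
    { intros t Ht. apply Cderiv_zero_segment. intros u Hu.
      replace (t * z + u * (z - t * z))%C with (RtoC (t + u * (1 - t)) * z)%C
        by (rewrite RtoC_plus, RtoC_mult, RtoC_minus; ring).
      assert (Hk : 0 < t + u * (1 - t) <= 1) by nra.
      apply Hds.
      - rewrite Cmod_mult, Cmod_R, Rabs_right by lra.
        apply Rle_lt_trans with (1 * Cmod z); [|lra].
        apply Rmult_le_compat_r; [apply Cmod_ge_0|lra].
      - apply Cmult_neq_0; [|easy]. intros E; apply RtoC_inj in E; lra. }
    assert (Hd : forall e, 0 < e -> Cmod (s z - s 0) < e).
    { intros e He. destruct (Hsc e He) as [d [Hd H]].
      set (t := Rmin 1 (d / 2)).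
      assert (Ht : 0 < t) by (apply Rmin_pos; lra).
      assert (Ht1 : t <= 1) by apply Rmin_l.
      assert (Ht2 : t <= d / 2) by apply Rmin_r.
      rewrite <- (Hray t) by lra. apply H.
      rewrite Cminus_0_r, Cmod_mult, Cmod_R, Rabs_right by lra.
      apply Rle_lt_trans with (t * 1); [apply Rmult_le_compat_l; lra|lra]. }
    replace (s z) with (s z - s 0 + s 0)%C by ring.
    replace (s z - s 0)%C with (RtoC 0); [ring|].
    symmetry. apply Cmod_eq_0. pose proof (Cmod_ge_0 (s z - s 0)).
    destruct (Rle_lt_or_eq_dec _ _ H) as [H'|H']; [|easy].
    specialize (Hd _ H'). lra. }
  exists (s 0); split.
  - assert (Hh : Cmod (RtoC (/ 2)) < 1) by (rewrite Cmod_R, Rabs_right; lra).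
    rewrite <- (Hcst (RtoC (/ 2)) Hh). apply Hs1; auto.
    intros E; apply RtoC_inj in E; lra.
  - intros z Hz. now rewrite Hfs, Hcst.
Qed.

Lemma Aut_disc_moebius (b : C) : Cmod b < 1 -> Aut_disc (moebius b).
Proof.
  intros Hb. assert (Hb' : Cmod (- b) < 1) by now rewrite Cmod_opp.
  split; [|split; [|split]]; unfold unit_disc.
  - apply analytic_on_has_Cderiv. intros z Hz. eexists.
    apply has_Cderiv_moebius, moebius_den; unfold unit_disc in Hz; lra.
  - intros z Hz. now apply Cmod_moebius_lt.
  - intros z w Hz Hw E.
    rewrite <- (moebius_opp_moebius b z), E by (auto; apply moebius_den; lra).
    apply moebius_opp_moebius; auto; apply moebius_den; lra.
  - intros w Hw. exists (moebius (- b) w). split; [now apply Cmod_moebius_lt|].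
    replace b with (- - b)%C at 1 by ring.
    apply moebius_opp_moebius; auto; apply moebius_den; lra.
Qed.

Lemma Aut_disc_comp (f g : C -> C) :
  Aut_disc f -> Aut_disc g -> Aut_disc (fun z => f (g z)).
Proof.
  intros [Hf1 [Hf2 [Hf3 Hf4]]] [Hg1 [Hg2 [Hg3 Hg4]]].
  rewrite analytic_on_has_Cderiv in Hf1, Hg1.
  split; [|split; [|split]]; auto.
  - apply analytic_on_has_Cderiv. intros z Hz.
    destruct (Hg1 z Hz) as [m Hm], (Hf1 (g z)) as [l Hl]; auto.
    exists (l * m)%C. now apply has_Cderiv_comp.
  - intros w Hw. destruct (Hf4 w Hw) as [v [Hv <-]], (Hg4 v Hv) as [u [Hu <-]]. now exists u.
Qed.

(** If [a] is the zero of [phi], composing with [moebius a], which sends 0 to [a], gives an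
    automorphism fixing 0, that is, a rotation. Undoing the composition yields b = - a. *)
Lemma Aut_disc_classification (phi : C -> C) :
  Aut_disc phi -> exists lam b, Cmod lam = 1 /\ Cmod b < 1 /\
    eq_on_disc phi (fun z => lam * moebius b z)%C.
Proof.
  intros HA. destruct (proj2 (proj2 (proj2 HA)) 0) as [a [Ha Ha0]].
  { unfold unit_disc. rewrite Cmod_0. lra. }
  unfold unit_disc in Ha.
  assert (Ha' : Cmod (- a) < 1) by now rewrite Cmod_opp.
  destruct (Aut_disc_fixing_0 (fun z => phi (moebius a z))) as [lam [Hlam H]].
  { now apply Aut_disc_comp; [|apply Aut_disc_moebius]. }
  { now rewrite moebius_0. }
  exists lam, (- a)%C. split; [easy|split; [easy|]].
  intros z Hz. rewrite <- H by now apply Cmod_moebius_lt.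
  f_equal. replace a with (- - a)%C at 1 by ring. symmetry.
  unfold unit_disc in Hz. apply moebius_opp_moebius; auto; apply moebius_den; lra.
Qed.

(** * The composition operator *)

(** Takes the place of the limits at the end point of the radius z = 1 - e. *)
Lemma le_0_of_le_small (x K : R) : (forall e, 0 < e < 1 -> x <= K * e) -> x <= 0.
Proof.
  intros H. apply Rnot_lt_le; intros Hx.
  set (e := Rmin (/ 2) (x / (2 * (Rabs K + 1)))).
  pose proof (Rabs_pos K). pose proof (Rle_abs K).
  assert (He : 0 < e) by (apply Rmin_pos; [lra|apply Rdiv_lt_0_compat; lra]).
  assert (He1 : e <= / 2) by apply Rmin_l.
  assert (He2 : e <= x / (2 * (Rabs K + 1))) by apply Rmin_r.
  specialize (H e ltac:(lra)).
  assert (K * e <= (Rabs K + 1) * (x / (2 * (Rabs K + 1)))) by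
    (apply Rle_trans with ((Rabs K + 1) * e);
      [apply Rmult_le_compat_r; lra|apply Rmult_le_compat_l; lra]).
  replace ((Rabs K + 1) * (x / (2 * (Rabs K + 1)))) with (x / 2) in * by (field; lra).
  lra.
Qed.

(** * The Poisson kernel under automorphisms *)

Definition poisson (z : C) : R := (1 - Cmod z ^ 2) / Cmod (1 - z) ^ 2.

Lemma one_minus_neq_0 (z : C) : Cmod z < 1 -> (1 - z <> 0)%C.
Proof.
  intros Hz E. replace z with (1 - (1 - z))%C in Hz by ring.
  rewrite E, Cminus_0_r, Cmod_1 in Hz. lra.
Qed.

Lemma Cmod_atomic_inner (alpha : R) (z : C) : Cmod z < 1 ->
  Cmod (atomic_inner alpha z) = exp (- (alpha * poisson z)).
Proof.
  intros Hz. pose proof (one_minus_neq_0 z Hz) as Hn.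
  unfold atomic_inner. rewrite Cmod_Cexp, re_scal_l. f_equal.
  pose proof (proj1 (Cmod_gt_0 _) Hn) as Hm. apply (pow_lt _ 2) in Hm.
  unfold poisson. revert Hm. rewrite !Cmod2_alt.
  destruct z as [x y]. simpl. unfold Re, Im; simpl. intros Hm. field. lra.
Qed.

Lemma has_Cderiv_rotated_moebius (lam b z : C) : (1 + Cconj b * z <> 0)%C ->
  has_Cderiv (fun z => lam * moebius b z)%C z
    (lam * ((1 - Cconj b * b) / ((1 + Cconj b * z) * (1 + Cconj b * z))))%C.
Proof.
  intros Hd. eapply has_Cderiv_eq.
  - apply has_Cderiv_mult; [apply has_Cderiv_const|now apply has_Cderiv_moebius].
  - cbv beta. ring.
Qed.

Lemma rotated_moebius_extension (phi : C -> C) (lam b : C) : Cmod b < 1 ->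
  eq_on_disc phi (fun z => lam * moebius b z)%C ->
  analytic_extension phi (fun z => lam * moebius b z)%C.
Proof.
  intros Hb Hphi. split.
  - intros z Hz. now rewrite Hphi.
  (* The complement of the pole, which lies outside the closed disc. *)
  - exists (fun z => (1 + Cconj b * z <> 0)%C). split; [|split].
    + intros z Hz. apply locally_C.
      destruct (Ccont_nonzero (fun z => 1 + Cconj b * z)%C z) as [d [Hd H]]; auto.
      { apply Ccont_plus; [apply Ccont_const|].
        apply Ccont_mult; [apply Ccont_const|apply Ccont_id]. }
      exists (mkposreal d Hd). intros w Hw. now apply H.
    + intros z Hz. now apply moebius_den.
    + apply analytic_on_has_Cderiv. intros z Hz. eexists. now apply has_Cderiv_rotated_moebius.
Qed.

(** The conditions [phi 1 = 1] and [phi' 1 = 1] for [phi = lam * moebius b]; given the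
    first one, the second reads [|1 + b|^2 = 1 - |b|^2]. *)
Definition parabolic_at_1 (lam b : C) : Prop :=
  (lam * (1 + b) = 1 + Cconj b)%C /\ ((1 + b) * (1 + Cconj b) = 1 - Cconj b * b)%C.

(** The derivative at 1 is lam (1 - |b|^2) / (1 + conj b)^2. Once lam = (1 + conj b) / (1 + b), this
    equals (1 - |b|^2) / |1 + b|^2. *)
Lemma parabolic_at_1_iff (lam b : C) : Cmod lam = 1 -> Cmod b < 1 ->
  parabolic_at_1 lam b <->
  (lam * moebius b 1)%C = 1 /\ has_Cderiv (fun z => lam * moebius b z)%C 1 1.
Proof.
  intros Hlam Hb.
  assert (Hd : (1 + Cconj b <> 0)%C).
  { replace (Cconj b) with (Cconj b * 1)%C by ring. apply moebius_den; auto.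
    rewrite Cmod_1; lra. }
  assert (Hl0 : lam <> 0) by (apply Cmod_gt_0; lra).
  assert (Hval : (lam * moebius b 1 * (1 + Cconj b) = lam * (1 + b))%C).
  { unfold moebius. rewrite Cmult_1_r. field. easy. }
  pose proof (has_Cderiv_rotated_moebius lam b 1) as Hder. rewrite Cmult_1_r in Hder.
  specialize (Hder Hd). split.
  - intros [H1 H2]. split.
    + rewrite H1 in Hval.
      replace (lam * moebius b 1)%C with (lam * moebius b 1 * (1 + Cconj b) / (1 + Cconj b))%C
        by (field; easy).
      rewrite Hval. now field.
    + assert (Hb0 : (1 + b <> 0)%C) by (intros E; apply Hd; rewrite <- H1, E; ring).
      eapply has_Cderiv_eq; [exact Hder|]. rewrite <- H2.
      replace lam with ((1 + Cconj b) / (1 + b))%C by (rewrite <- H1; now field).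
      field. auto.
  - intros [H1 H2]. rewrite H1 in Hval. split; [rewrite <- Hval; ring|].
    pose proof (has_Cderiv_unique _ _ _ _ Hder H2) as E.
    assert (E2 : (lam * (1 - Cconj b * b) = lam * ((1 + b) * (1 + Cconj b)))%C).
    { replace (lam * (1 - Cconj b * b))%C with
        (lam * ((1 - Cconj b * b) / ((1 + Cconj b) * (1 + Cconj b)))
           * ((1 + Cconj b) * (1 + Cconj b)))%C by (field; easy).
      rewrite E, (Cmult_assoc lam), <- Hval. ring. }
    replace (1 - Cconj b * b)%C with (/ lam * (lam * (1 - Cconj b * b)))%C by (field; easy).
    rewrite E2. field. easy.
Qed.

(** The second factor is |(1 - phi z) (1 + conj b z)|^2. In this multiplied form the kernel at phi z
    can be followed as z tends to 1, where 1 - phi z may tend to 0. *)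
Lemma poisson_rotated_moebius (lam b z : C) : Cmod lam = 1 -> Cmod b < 1 -> Cmod z < 1 ->
  poisson (lam * moebius b z) * Cmod (1 + Cconj b * z - lam * (z + b)) ^ 2 =
  (1 - Cmod b ^ 2) * (1 - Cmod z ^ 2).
Proof.
  intros Hlam Hb Hz. unfold poisson.
  pose proof (moebius_den b z Hb ltac:(lra)) as Hd.
  assert (Hm : Cmod (lam * moebius b z) < 1).
  { rewrite Cmod_mult, Hlam, Rmult_1_l. now apply Cmod_moebius_lt. }
  pose proof (one_minus_neq_0 _ Hm) as Hn.
  replace (1 + Cconj b * z - lam * (z + b))%C
    with ((1 - lam * moebius b z) * (1 + Cconj b * z))%C by (unfold moebius; field; easy).
  rewrite (Cmod_mult lam), Hlam, Rmult_1_l, one_minus_Cmod2_moebius by lra.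
  rewrite Cmod_mult. apply Cmod_gt_0 in Hd, Hn. field. lra.
Qed.

Lemma poisson_real (r : R) : 0 < r < 1 -> poisson r * (1 - r) = 1 + r.
Proof.
  intros Hr. unfold poisson. rewrite <- RtoC_minus, !Cmod_R, !Rabs_right by lra.
  field. lra.
Qed.

(** At z = 1 - e the two kernels are (2 - e) / e and k e (2 - e) / L(e)^2. If L(0) were nonzero,
    only the first would blow up; so L(0) = 0, which is phi(1) = 1. Then L(e) is e |lam - conj b|,
    and comparing the coefficients of 1 / e gives |lam - conj b|^2 = k. *)
Lemma bounded_poisson_parabolic (lam b : C) (K : R) : Cmod lam = 1 -> Cmod b < 1 ->
  (forall z, Cmod z < 1 -> Rabs (poisson (lam * moebius b z) - poisson z) <= K) ->
  parabolic_at_1 lam b.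
Proof.
  intros Hlam Hb HK.
  set (k := 1 - Cmod b ^ 2).
  assert (Hk : 0 < k) by (apply sq_lt_1; [apply Cmod_ge_0|easy]).
  assert (Hk1 : k <= 1) by (unfold k; pose proof (pow2_ge_0 (Cmod b)); lra).
  (* [L e] is |(1 - phi z) (1 + conj b z)| at z = 1 - e. Multiplying the hypothesis by [e * L e ^ 2]
     clears all denominators. *)
  set (L := fun e : R => Cmod (1 + Cconj b * RtoC (1 - e) - lam * (RtoC (1 - e) + b))).
  assert (HL : forall e, 0 < e < 1 ->
    (2 - e) * L e ^ 2 <= k * e ^ 2 * (2 - e) + K * e * L e ^ 2 /\
    k * e ^ 2 * (2 - e) <= (2 - e) * L e ^ 2 + K * e * L e ^ 2).
  { intros e He.
    assert (Hz : Cmod (RtoC (1 - e)) < 1) by (rewrite Cmod_R, Rabs_right; lra).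
    pose proof (poisson_rotated_moebius lam b _ Hlam Hb Hz) as H1.
    pose proof (poisson_real (1 - e) ltac:(lra)) as H2.
    specialize (HK _ Hz). apply Rabs_le_between in HK.
    fold (L e) in H1. fold k in H1. rewrite Cmod_R, Rabs_right in H1 by lra.
    set (P' := poisson (lam * moebius b (1 - e)%R)) in *.
    set (P := poisson (1 - e)%R) in *.
    pose proof (pow2_ge_0 (L e)) as HLe.
    assert (HeL : 0 <= e * L e ^ 2) by (apply Rmult_le_pos; lra).
    assert (E1 : P * (e * L e ^ 2) = (2 - e) * L e ^ 2)
      by (replace (2 - e) with (1 + (1 - e)) by ring; rewrite <- H2; ring).
    assert (E2 : P' * (e * L e ^ 2) = k * e ^ 2 * (2 - e))
      by (transitivity (e * (P' * L e ^ 2)); [ring|rewrite H1; ring]).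
    rewrite <- E2, <- E1.
    split.
    - apply Rle_trans with ((P' + K) * (e * L e ^ 2)); [|right; ring].
      apply Rmult_le_compat_r; lra.
    - apply Rle_trans with ((P + K) * (e * L e ^ 2)); [|right; ring].
      apply Rmult_le_compat_r; lra. }
  assert (HK0 : 0 <= K).
  { specialize (HK 0). rewrite Cmod_0 in HK. eapply Rle_trans; [apply Rabs_pos|apply HK; lra]. }
  set (m := Cmod (1 + Cconj b - lam * (1 + b))).
  assert (Hlb : Cmod (Cconj b - lam) <= 2).
  { eapply Rle_trans; [apply Cmod_triangle|]. rewrite Cmod_opp, Cmod_conj, Hlam. lra. }
  assert (HLm : forall e, 0 < e < 1 -> m - 2 * e <= L e /\ L e <= 6).
  { intros e He. unfold L, m.
    assert (E : (1 + Cconj b * RtoC (1 - e) - lam * (RtoC (1 - e) + b))%C =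
            ((1 + Cconj b - lam * (1 + b)) + - (RtoC e * (Cconj b - lam)))%C)
      by (rewrite RtoC_minus; ring).
    assert (H2 : Cmod (- (RtoC e * (Cconj b - lam))) <= 2 * e).
    { rewrite Cmod_opp, Cmod_mult, Cmod_R, Rabs_right by lra.
      rewrite Rmult_comm. apply Rmult_le_compat_r; lra. }
    assert (H3 : Cmod (1 + Cconj b - lam * (1 + b)) <= 4).
    { eapply Rle_trans; [apply Cmod_triangle|]. rewrite Cmod_opp, Cmod_mult, Hlam.
      pose proof (Cmod_triangle 1 (Cconj b)) as A. pose proof (Cmod_triangle 1 b) as B.
      rewrite Cmod_conj, Cmod_1 in A. rewrite Cmod_1 in B. lra. }
    rewrite E. split.
    - pose proof (Cmod_plus_ge (1 + Cconj b - lam * (1 + b)) (- (RtoC e * (Cconj b - lam)))). lra.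
    - eapply Rle_trans; [apply Cmod_triangle|]. lra. }
  assert (Hm0 : 0 <= m) by apply Cmod_ge_0.
  assert (Hm : m ^ 2 <= 0).
  { apply (le_0_of_le_small _ (2 + 36 * K + 4 * m)). intros e He.
    destruct (HL e He) as [H1 _]. destruct (HLm e He) as [H2 H3].
    assert (HLe0 : 0 <= L e) by apply Cmod_ge_0.
    assert (HL2 : L e ^ 2 <= 36) by nra.
    assert (HLsq : m ^ 2 - 4 * m * e <= L e ^ 2).
    { destruct (Rle_dec (2 * e) m) as [Hc|Hc]; nra. }
    assert (H4 : K * e * L e ^ 2 <= K * e * 36)
      by (apply Rmult_le_compat_l; [apply Rmult_le_pos; lra|easy]).
    assert (H5 : k * e ^ 2 * (2 - e) <= 2 * e).
    { assert (k * e ^ 2 <= 1 * e) by (apply Rmult_le_compat; nra).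
      assert (k * e ^ 2 * (2 - e) <= e * 2) by (apply Rmult_le_compat; nra). lra. }
    assert (H6 : L e ^ 2 <= (2 - e) * L e ^ 2)
      by (rewrite <- (Rmult_1_l (L e ^ 2)) at 1; apply Rmult_le_compat_r; [apply pow2_ge_0|lra]).
    lra. }
  assert (Hfix : (lam * (1 + b) = 1 + Cconj b)%C).
  { assert (E : (1 + Cconj b - lam * (1 + b))%C = 0) by (apply Cmod_eq_0; fold m; nra).
    replace (1 + Cconj b)%C with (1 + Cconj b - lam * (1 + b) + lam * (1 + b))%C by ring.
    rewrite E. ring. }
  split; [easy|].
  (* With the constant term gone, [L e] is exactly linear in [e], and the factor [e ^ 2] cancels
     from both inequalities. *)
  set (S := Cmod (lam - Cconj b) ^ 2).
  assert (HLS : forall e, 0 < e < 1 -> L e ^ 2 = e ^ 2 * S).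
  { intros e He. unfold L, S.
    replace (1 + Cconj b * RtoC (1 - e) - lam * (RtoC (1 - e) + b))%C
      with (RtoC e * (lam - Cconj b) + (1 + Cconj b - lam * (1 + b)))%C
      by (rewrite RtoC_minus; ring).
    rewrite Hfix.
    replace (RtoC e * (lam - Cconj b) + (1 + Cconj b - (1 + Cconj b)))%C
      with (RtoC e * (lam - Cconj b))%C by ring.
    rewrite Cmod_mult, Cmod_R, Rabs_right by lra. ring. }
  assert (HS : forall e, 0 < e < 1 ->
    (2 - e) * S <= k * (2 - e) + K * e * S /\ k * (2 - e) <= (2 - e) * S + K * e * S).
  { intros e He. destruct (HL e He) as [H1 H2]. rewrite HLS in H1, H2 by easy.
    assert (0 < e ^ 2) by (apply pow_lt; lra).
    split; apply (Rmult_le_reg_l (e ^ 2)); auto; lra. }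
  assert (HSk : S = k).
  { apply Rle_antisym.
    - assert (2 * (S - k) <= 0); [|lra].
      apply (le_0_of_le_small _ (K * S + (S - k))). intros e He.
      destruct (HS e He). lra.
    - assert (2 * (k - S) <= 0); [|lra].
      apply (le_0_of_le_small _ (K * S + (k - S))). intros e He.
      destruct (HS e He). lra. }
  assert (Hkc : RtoC k = (1 - Cconj b * b)%C).
  { unfold k. rewrite RtoC_minus, Cmod2_conj. ring. }
  (* By the fixed point equation the terms in conj b cancel. Taking moduli turns [S = k] into |1 +
     b|^2 = k, the condition on the derivative. *)
  assert (E : ((lam - Cconj b) * (1 + b))%C = RtoC k).
  { rewrite Hkc. replace ((lam - Cconj b) * (1 + b))%C
      with (lam * (1 + b) - Cconj b * (1 + b))%C by ring. rewrite Hfix. ring. }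
  assert (E2 : k * Cmod (1 + b) ^ 2 = k * k).
  { rewrite <- HSk at 1. unfold S. rewrite <- Rpow_mult_distr, <- Cmod_mult, E, Cmod_R.
    rewrite Rabs_right by lra. ring. }
  apply Rmult_eq_reg_l in E2; [|lra].
  rewrite <- Hkc, <- E2, Cmod2_conj, Cplus_conj. f_equal. f_equal.
  apply injective_projections; simpl; ring.
Qed.

(** The map translates (z + 1) / (z - 1) by (conj b - b) / k, a purely imaginary number since k is
    real. The exponential of [alpha] times this translation is [kappa]. *)
Lemma atomic_inner_parabolic (alpha : R) (lam b : C) : Cmod lam = 1 -> Cmod b < 1 ->
  parabolic_at_1 lam b ->
  exists kappa : C, kappa <> 0 /\ forall z, Cmod z < 1 ->
    atomic_inner alpha (lam * moebius b z)%C = (kappa * atomic_inner alpha z)%C.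
Proof.
  intros Hlam Hb [H1 H2].
  set (k := (1 - Cconj b * b)%C) in *.
  assert (Hk : k <> 0).
  { pose proof (moebius_den (- b) b) as H. rewrite Cmod_opp, Copp_conj in H.
    unfold k. replace (1 - Cconj b * b)%C with (1 + - Cconj b * b)%C by ring.
    apply H; lra. }
  exists (Cexp (RtoC alpha * ((Cconj b - b) / k)))%C. split.
  { apply Cmod_gt_0. rewrite Cmod_Cexp. apply exp_pos. }
  intros z Hz. unfold atomic_inner. rewrite <- Cexp_plus. f_equal.
  pose proof (moebius_den b z Hb ltac:(lra)) as Hd.
  assert (Hb0 : (1 + b <> 0)%C) by (intros E; apply Hk; rewrite <- H2, E; ring).
  assert (Hz1 : (z - 1 <> 0)%C).
  { intros E. apply (one_minus_neq_0 z Hz). replace (1 - z)%C with (- (z - 1))%C by ring.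
    rewrite E. ring. }
  assert (Hl : lam = ((1 + Cconj b) / (1 + b))%C) by (rewrite <- H1; field; easy).
  assert (Hden : (lam * moebius b z - 1 = k * (z - 1) / ((1 + b) * (1 + Cconj b * z)))%C).
  { rewrite Hl. unfold moebius, k. field. auto. }
  assert (Hnum : (lam * moebius b z + 1 =
     (k * (z + 1) + (Cconj b - b) * (z - 1)) / ((1 + b) * (1 + Cconj b * z)))%C).
  (* The sum of the two expressions for [k], (1 + b) (1 + conj b) and 1 - |b|^2, in which |b|^2
     cancels. *)
  { assert (Hkk : (2 * k = 2 + b + Cconj b)%C).
    { replace (2 * k)%C with (k + k)%C by ring. rewrite <- H2 at 1. unfold k. ring. }
    replace (k * (z + 1) + (Cconj b - b) * (z - 1))%C
      with ((1 + Cconj b) * (z + b) + (1 + b) * (1 + Cconj b * z))%C.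
    - rewrite Hl. unfold moebius. field. auto.
    - replace (k * (z + 1))%C with ((2 * k - k) * (z + 1))%C by ring.
      rewrite Hkk. unfold k. ring. }
  rewrite Hnum, Hden. field. repeat split; auto.
Qed.

(** The difference vanishes at the points 1 - t of the radius, and these already determine the value
    and the difference quotients at 1. *)
Lemma deriv_at_1_of_eq_on_disc (f g : C -> C) (l m : C) :
  eq_on_disc f g -> has_Cderiv f 1 l -> has_Cderiv g 1 m -> f 1 = g 1 /\ l = m.
Proof.
  intros Heq Hf Hg.
  assert (Hd : has_Cderiv (fun z => f z + (- (1)) * g z)%C 1 (l + (0 * g 1 + - (1) * m))).
  { apply has_Cderiv_plus; [easy|].
    apply (has_Cderiv_mult (fun _ => - (1))%C g); [apply has_Cderiv_const|easy]. }
  set (h := (fun z => f z + (- (1)) * g z)%C) in *.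
  assert (Hh : forall t : R, 0 < t < 1 -> h (1 - t)%C = 0).
  { intros t Ht. unfold h. rewrite Heq; [ring|].
    unfold unit_disc. rewrite <- RtoC_minus, Cmod_R, Rabs_right; lra. }
  assert (Ht0 : forall t : R, (1 - t - 1)%C = (- t)%C) by (intros; ring).
  assert (Hsmall : forall x : R, 0 <= x -> (forall e, 0 < e -> x <= e) -> x = 0).
  { intros x Hx H. apply Rle_antisym; [|easy]. apply le_epsilon. intros e He.
    rewrite Rplus_0_l. auto. }
  assert (H0 : h 1 = 0).
  { apply Cmod_eq_0, Hsmall; [apply Cmod_ge_0|]. intros e He.
    destruct (has_Cderiv_cont _ _ _ Hd e He) as [d [Hd0 H]].
    set (t := Rmin (/ 2) (d / 2)).
    assert (Ht : 0 < t) by (apply Rmin_pos; lra).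
    assert (t <= / 2) by apply Rmin_l. assert (t <= d / 2) by apply Rmin_r.
    specialize (H (1 - t)%C). rewrite Ht0, Cmod_opp, Cmod_R, Rabs_right in H by lra.
    rewrite Hh in H by lra. rewrite Cmod_minus_sym, Cminus_0_r in H. apply Rlt_le, H. lra. }
  assert (Hl : (l + (0 * g 1 + - (1) * m))%C = 0).
  { apply Cmod_eq_0, Hsmall; [apply Cmod_ge_0|]. intros e He.
    destruct (Hd e He) as [d [Hd0 H]].
    set (t := Rmin (/ 2) (d / 2)).
    assert (Ht : 0 < t) by (apply Rmin_pos; lra).
    assert (t <= / 2) by apply Rmin_l. assert (t <= d / 2) by apply Rmin_r.
    specialize (H (1 - t)%C). rewrite Ht0, Cmod_opp, Cmod_R, Rabs_right in H by lra.
    rewrite Hh, H0 in H by lra. specialize (H ltac:(lra)).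
    replace (0 - 0 - (l + (0 * g 1 + - (1) * m)) * - t)%C
      with ((l + (0 * g 1 + - (1) * m)) * t)%C in H by ring.
    rewrite Cmod_mult, Cmod_R, Rabs_right in H by lra.
    now apply Rmult_le_reg_r in H. }
  split.
  - replace (f 1) with (h 1 + g 1)%C by (unfold h; ring). rewrite H0. ring.
  - replace l with (l + (0 * g 1 + - (1) * m) + m)%C by ring. rewrite Hl. ring.
Qed.

(** * Composition on multiples of a fixed function *)

Lemma H_infty_const (c : C) : H_infty (fun _ => c).
Proof.
  split.
  - apply analytic_on_has_Cderiv. intros z _. exists 0. apply has_Cderiv_const.
  - exists (Cmod c). intros; lra.
Qed.

Lemma H_infty_scal_comp (c : C) (F g : C -> C) :
  H_infty F -> (forall z, Cmod z < 1 -> exists l, has_Cderiv g z l) ->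
  (forall z, Cmod z < 1 -> Cmod (g z) < 1) ->
  H_infty (fun z => c * F (g z))%C.
Proof.
  intros [HF [M HM]] Hg Hgd. rewrite analytic_on_has_Cderiv in HF. split.
  - apply analytic_on_has_Cderiv. intros z Hz.
    destruct (Hg z Hz) as [m Hm], (HF (g z)) as [l Hl]; [now apply Hgd|].
    eexists. apply (has_Cderiv_mult (fun _ => c) (fun z => F (g z)));
      [apply has_Cderiv_const|].
    apply has_Cderiv_comp; [exact Hl|exact Hm].
  - exists (Cmod c * M). intros z Hz. rewrite Cmod_mult.
    apply Rmult_le_compat_l; [apply Cmod_ge_0|]. now apply HM, Hgd.
Qed.

Lemma mult_H_infty_self (psi : C -> C) : mult_H_infty psi psi.
Proof. exists (fun _ => RtoC 1). split; [apply H_infty_const|]. intros z _. ring. Qed.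

Lemma exp_mult_bound (x y M : R) : 0 < M -> exp x <= exp y * M -> x <= y + ln M.
Proof.
  intros HM H. rewrite <- (exp_ln M HM), <- exp_plus in H.
  destruct (Rle_or_lt x (y + ln M)) as [Hle|Hlt]; [easy|].
  apply exp_increasing in Hlt. lra.
Qed.

(** The image of psi gives psi o phi = psi F, and a preimage psi G of psi gives psi = (psi o phi) (G
    o phi). Logarithms of moduli bound [alpha] times the difference of the kernels from both
    sides. *)
Lemma automorphism_poisson_bounded (phi : C -> C) (alpha : R) :
  0 < alpha -> (forall z, Cmod z < 1 -> Cmod (phi z) < 1) ->
  algebra_automorphism (mult_H_infty (atomic_inner alpha)) (composition_operator phi) ->
  exists K, forall z, Cmod z < 1 -> Rabs (poisson (phi z) - poisson z) <= K.
Proof.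
  intros Ha Hphi [_ [Hinto [_ [_ [_ [_ Honto]]]]]].
  destruct (Hinto _ (mult_H_infty_self (atomic_inner alpha))) as [F [[_ [M1 HM1]] HF]].
  destruct (Honto _ (mult_H_infty_self (atomic_inner alpha)))
    as [h [[G [[_ [M2 HM2]] HG]] Hh]].
  unfold composition_operator, eq_on_disc, unit_disc in *.
  (* The 1 makes [M] positive, as taking its logarithm requires. *)
  set (M := Rmax 1 (Rmax M1 M2)).
  assert (HMpos : 1 <= M) by apply Rmax_l.
  assert (HMM1 : M1 <= M) by (eapply Rle_trans; [apply Rmax_l|apply Rmax_r]).
  assert (HMM2 : M2 <= M) by (eapply Rle_trans; [apply Rmax_r|apply Rmax_r]).
  exists (ln M / alpha). intros z Hz. pose proof (Hphi z Hz) as Hpz.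
  pose proof (HF z Hz) as E1. apply (f_equal Cmod) in E1.
  pose proof (Hh z Hz) as E2. rewrite HG in E2 by easy. apply (f_equal Cmod) in E2.
  rewrite Cmod_mult, !Cmod_atomic_inner in E1, E2 by easy.
  assert (B1 : - (alpha * poisson (phi z)) <= - (alpha * poisson z) + ln M).
  { apply exp_mult_bound; [lra|]. rewrite E1.
    apply Rmult_le_compat_l; [apply Rlt_le, exp_pos|]. specialize (HM1 z Hz). lra. }
  assert (B2 : - (alpha * poisson z) <= - (alpha * poisson (phi z)) + ln M).
  { apply exp_mult_bound; [lra|]. rewrite <- E2.
    apply Rmult_le_compat_l; [apply Rlt_le, exp_pos|]. specialize (HM2 _ Hpz). lra. }
  apply Rabs_le.
  assert (E : alpha * (ln M / alpha) = ln M) by (field; lra).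
  split; apply (Rmult_le_reg_l alpha); auto; lra.
Qed.

(** Composition takes psi F to psi times kappa (F o phi). The preimage of psi G is psi times (1 /
    kappa) (G o eta), with eta the inverse of [phi], whose differentiability puts G o eta in
    H^infty. *)
Lemma automorphism_of_multiplier (phi psi : C -> C) (kappa : C) :
  Aut_disc phi -> kappa <> 0 ->
  (forall z, Cmod z < 1 -> psi (phi z) = (kappa * psi z)%C) ->
  algebra_automorphism (mult_H_infty psi) (composition_operator phi).
Proof.
  intros HA Hk Hpsi. destruct (Aut_disc_inverse phi HA) as [eta [Heta1 [Heta2 Heta3]]].
  destruct HA as [Hf [Hmap [Hinj Hsurj]]]. rewrite analytic_on_has_Cderiv in Hf.
  unfold composition_operator.
  repeat split; try (intros; intro; intros; reflexivity).
  - intros f g _ _ E z Hz. apply E, Hmap, Hz.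
  - intros f [F [HF E]]. exists (fun z => kappa * F (phi z))%C. split.
    + now apply H_infty_scal_comp.
    + intros z Hz. rewrite E by now apply Hmap. rewrite Hpsi by easy. ring.
  - intros f g _ _ E w Hw. destruct (Hsurj w Hw) as [z [Hz <-]]. now apply E.
  - intros g [G [HG E]].
    exists (fun w => psi w * (/ kappa * G (eta w)))%C. split.
    + exists (fun w => / kappa * G (eta w))%C. split; [|now intros z _].
      apply H_infty_scal_comp; auto. intros w Hw. now apply Heta2.
    + intros z Hz. rewrite Hpsi, Heta3, E by easy. field. easy.
Qed.

Theorem theorem6p1 (phi : C -> C) (alpha : R) :
  Aut_disc phi ->
  0 < alpha ->
  algebra_automorphism (mult_H_infty (atomic_inner alpha))
                       (composition_operator phi) <->
  exists Phi : C -> C,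
    analytic_extension phi Phi /\
    Phi (RtoC 1) = RtoC 1 /\
    @is_derive C_AbsRing C_NormedModule Phi (RtoC 1) (RtoC 1).
Proof.
  intros HA Ha.
  destruct (Aut_disc_classification phi HA) as [lam [b [Hlam [Hb Hphi]]]].
  split.
  - intros Haut.
    destruct (automorphism_poisson_bounded phi alpha Ha) as [K HK]; auto.
    { exact (proj1 (proj2 HA)). }
    assert (Hpar : parabolic_at_1 lam b).
    { apply (bounded_poisson_parabolic lam b K); auto.
      intros z Hz. rewrite <- Hphi by easy. auto. }
    apply parabolic_at_1_iff in Hpar as [H1 H2]; auto.
    exists (fun z => lam * moebius b z)%C. split; [|split; [easy|]].
    + now apply rotated_moebius_extension.
    + now apply has_Cderiv_is_derive.
  - intros [Phi [[HPhi _] [H1 H2]]]. apply has_Cderiv_is_derive in H2.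
    (* An arbitrary extension shares its value and derivative at 1 with the Moebius formula, so its
       two conditions become conditions on [lam] and [b]. *)
    assert (Heq : eq_on_disc (fun z => lam * moebius b z)%C Phi).
    { intros z Hz. now rewrite HPhi, Hphi. }
    assert (Hd : (1 + Cconj b * 1 <> 0)%C) by (apply moebius_den; auto; rewrite Cmod_1; lra).
    pose proof (has_Cderiv_rotated_moebius lam b 1 Hd) as H3.
    destruct (deriv_at_1_of_eq_on_disc _ _ _ _ Heq H3 H2) as [E1 E2].
    assert (Hpar : parabolic_at_1 lam b).
    { apply parabolic_at_1_iff; auto. split; [congruence|]. now rewrite E2 in H3. }
    destruct (atomic_inner_parabolic alpha lam b Hlam Hb Hpar) as [kappa [Hk Hpsi]].
    apply (automorphism_of_multiplier phi _ kappa); auto.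
    intros z Hz. rewrite Hphi by easy. auto.
Qed.
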